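(* Let $n\ge 1$, let $\varphi:\mathbb{R}^+\to\mathbb{R}^+\cup\{0\}$ be measurable with $\int_{\mathbb{R}^n}\varphi(|x|)\,dx=1$. Let $(\Omega,\mathscr{F},\mathscr{P})$ be a probability space, and for each $j\in\mathbb{Z}^+$ let $\varepsilon_j:\Omega\to\mathbb{R}^+$ be a positive random variable and $y_j:\Omega\to\mathbb{R}^n$ a random vector. Assume that the joint distribution $\Pi_j$ of $(\varepsilon_j,y_j)$ converges weakly to $\delta_{(0,\mathbf{0})}$, the Dirac unit mass at $(0,\mathbf{0})\in\mathbb{R}^{n+1}$, as $j\to\infty$, and that the maximal operator $$\mathscr{M}f(x)=\sup_{j\geq 1}\mathscr{E}\left[\int_{z\in\mathbb{R}^n}\frac{1}{\varepsilon_j^n(\omega)}\varphi\left(\frac{|x-y_j(\omega)-z|}{\varepsilon_j(\omega)}\right)|f(z)|\,dz\right]$$ is of weak type $(1,1)$. Then for every $f\in L^1(\mathbb{R}^n)$ we have $m_j(f)(x)\to f(x)$ as $j\to\infty$ for almost every $x\in\mathbb{R}^n$.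
   Context: $\mathbb{R}^+=\{t\in\mathbb{R}:t>0\}$, $\mathbb{Z}^+=\{1,2,3,\dots\}$. $\mathscr{E}$ denotes expectation with respect to $\mathscr{P}$. The joint distribution of $(\varepsilon_j,y_j)$ is $\Pi_j(E)=\mathscr{P}(\{\omega:(\varepsilon_j(\omega),y_j(\omega))\in E\})$ for Borel $E\subseteq\mathbb{R}^{n+1}$. Weak (also called vague) convergence of $\Pi_j$ to $\delta_{(0,\mathbf{0})}$ means $\int g\,d\Pi_j\to g(0,\mathbf{0})$ for every bounded continuous $g:\mathbb{R}^{n+1}\to\mathbb{R}$. The mean operators are $$m_j(f)(x)=\mathscr{E}\left[\frac{1}{\varepsilon_j^n(\omega)}\int_{z\in\mathbb{R}^n}\varphi\left(\frac{|x-z-y_j(\omega)|}{\varepsilon_j(\omega)}\right)f(z)\,dz\right];$$ for $f\in L^1(\mathbb{R}^n)$ the integral converges absolutely for almost every $x$. $\mathscr{M}$ is of weak type $(1,1)$ if there is a constant $A>0$ such that $|\{x\in\mathbb{R}^n:\mathscr{M}f(x)>\lambda\}|\le\frac{A}{\lambda}\|f\|_{L^1(\mathbb{R}^n)}$ for every $\lambda>0$ and every $f\in L^1(\mathbb{R}^n)$, where $|\cdot|$ of a set is Lebesgue measure. *)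

(* Defs.v *)
From HB Require Import structures.
From mathcomp Require Import all_boot all_order all_algebra.
From mathcomp Require Import all_classical all_reals all_analysis.

Set Implicit Arguments.
Unset Strict Implicit.
Unset Printing Implicit Defensive.

Import Order.TTheory GRing.Theory Num.Theory.
Import numFieldNormedType.Exports.

Local Open Scope classical_set_scope.
Local Open Scope ring_scope.

(* The product sigma-algebra on row vectors, generated by the coordinate maps
   exactly as in the library instance for [n.-tuple T]; for [T = R] it is the
   Borel sigma-algebra of R^n. *)
Section measurable_rV.
Context {d : measure_display} {T : sigmaRingType d} (n : nat).

Let coord (i : 'I_n) (x : 'rV[T]_n) : T := x ord0 i.

Let rV_set0 : g_sigma_preimage coord set0.
Proof. exact: sigma_algebra0. Qed.

Let rV_setC A : g_sigma_preimage coord A -> g_sigma_preimage coord (~` A).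
Proof. exact: sigma_algebraC. Qed.

Let rV_bigcup (F : (set 'rV[T]_n)^nat) :
  (forall i, g_sigma_preimage coord (F i)) ->
  g_sigma_preimage coord (\bigcup_i (F i)).
Proof. exact: sigma_algebra_bigcup. Qed.

HB.instance Definition _ := @isMeasurable.Build (measure_tuple_display d)
  'rV[T]_n (g_sigma_preimage coord) rV_set0 rV_setC rV_bigcup.

End measurable_rV.

Lemma measurable_rV_coord d (T : sigmaRingType d) n (i : 'I_n) :
  measurable_fun [set: 'rV[T]_n] (fun x => x ord0 i).
Proof.
move=> _ Y mY; rewrite setTI; apply: sub_sigma_algebra => /=.
rewrite -bigcup_seq/=; exists i => /=; first by rewrite mem_index_enum.
by exists Y => //; rewrite setTI.
Qed.

Lemma measurable_fun_rVP d1 d2 (T1 : measurableType d1) (T2 : measurableType d2)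
    n (f : T1 -> 'rV[T2]_n) :
  measurable_fun [set: T1] f <->
  forall i, measurable_fun [set: T1] (fun t => f t ord0 i).
Proof.
split=> [mf i|mf].
  exact: (measurableT_comp (@measurable_rV_coord _ _ _ i) mf).
move=> _ A; rewrite setTI => mA.
suff : measurable `<=` [set B | measurable (f @^-1` B)] by apply.
apply: smallest_sub.
  split => /=; first by rewrite preimage_set0.
  - by move=> B mB; rewrite setTD preimage_setC; exact: measurableC.
  - by move=> F mF; rewrite preimage_bigcup; exact: bigcupT_measurable.
rewrite -bigcup_seq => B [i /= _] [C mC <-{B}] /=.
rewrite setTI -[X in measurable X]setTI; exact: mf.
Qed.

Section cons_measure.
Context {R : realType} (n : nat).

Definition cons_rV (p : measurableTypeR R * 'rV[R]_n) : 'rV[R]_n.+1 :=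
  row_mx (const_mx p.1 : 'rV[R]_1) p.2.

Definition uncons_rV (v : 'rV[R]_n.+1) : measurableTypeR R * 'rV[R]_n :=
  (v ord0 ord0, \row_j v ord0 (lift ord0 j)).

Lemma cons_rV0 p : cons_rV p ord0 ord0 = p.1.
Proof.
rewrite /cons_rV (_ : ord0 = lshift n (ord0 : 'I_1)); last exact/val_inj.
by rewrite (row_mxEl (const_mx p.1 : 'rV[R]_1)) mxE.
Qed.

Lemma cons_rVS p j : cons_rV p ord0 (lift ord0 j) = p.2 ord0 j.
Proof.
rewrite /cons_rV (_ : lift ord0 j = rshift 1 j); last exact/val_inj.
by rewrite (row_mxEr (const_mx p.1 : 'rV[R]_1)).
Qed.

Lemma cons_rVK : cancel cons_rV uncons_rV.
Proof.
move=> [t v]; rewrite /uncons_rV cons_rV0; congr pair.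
by apply/rowP => j; rewrite mxE cons_rVS.
Qed.

Lemma measurable_cons_rV : measurable_fun setT cons_rV.
Proof.
apply/measurable_fun_rVP => i; case: (unliftP ord0 i) => [j|] ->.
  rewrite (_ : (fun _ => _) = (fun x : 'rV[R]_n => x ord0 j) \o snd).
    exact: (measurableT_comp (@measurable_rV_coord _ _ _ j) measurable_snd).
  by apply/funext => p /=; rewrite cons_rVS.
rewrite (_ : (fun _ => _) = fst); first exact: measurable_fst.
by apply/funext => p; rewrite cons_rV0.
Qed.

Lemma measurable_uncons_rV : measurable_fun setT uncons_rV.
Proof.
apply: measurable_fun_pair; first exact: measurable_rV_coord.
apply/measurable_fun_rVP => i; under eq_fun do rewrite mxE.
exact: measurable_rV_coord.
Qed.

Variable mu : {sigma_finite_measure set 'rV[R]_n -> \bar R}.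

Definition cons_measure : set 'rV[R]_n.+1 -> \bar R :=
  pushforward (lebesgue_measure \x mu)%E cons_rV.

Let cons_measure0 : cons_measure set0 = 0%E.
Proof. by rewrite /cons_measure/pushforward preimage_set0 measure0. Qed.

Let cons_measure_ge0 A : (0 <= cons_measure A)%E.
Proof. by rewrite /cons_measure/pushforward; exact: measure_ge0. Qed.

Let cons_measure_sigma_additive : semi_sigma_additive cons_measure.
Proof.
move=> F mF tF mUF; rewrite /cons_measure/pushforward preimage_bigcup.
have mcons A : measurable A -> measurable (cons_rV @^-1` A).
  by move=> mA; rewrite -[X in measurable X]setTI; exact: measurable_cons_rV.
apply: measure_semi_sigma_additive.
- by move=> i; exact: mcons.
- apply/trivIsetP => i j _ _ ij; rewrite -preimage_setI.
  by move/trivIsetP : tF => /(_ i j I I ij) ->; rewrite preimage_set0.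
- by rewrite -preimage_bigcup; exact: mcons.
Qed.

HB.instance Definition _ := isMeasure.Build _ _ _ cons_measure
  cons_measure0 cons_measure_ge0 cons_measure_sigma_additive.

Let cons_measure_sigma_finite : sigma_finite setT cons_measure.
Proof.
have /sigma_finiteP[F [TF ndF Foo]] := sigma_finiteT (@lebesgue_measure R).
have /sigma_finiteP[G [TG ndG Goo]] := sigma_finiteT mu.
exists (fun k => uncons_rV @^-1` (F k `*` G k)).
  rewrite -preimage_bigcup -[LHS](preimage_setT uncons_rV); congr (_ @^-1` _).
  rewrite -setXTT TF TG; apply/seteqP; split=> -[x y] /=.
    move=> [[k _ Fkx] [l _ Gly]]; exists (maxn k l) => //; split.
    - by move: x Fkx; exact/subsetPset/ndF/leq_maxl.
    - by move: y Gly; exact/subsetPset/ndG/leq_maxr.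
  by move=> [k _ [/= ? ?]]; split; exists k.
move=> k; have [mF Fkoo] := Foo k; have [mG Gkoo] := Goo k; split.
  rewrite -[X in measurable X]setTI; apply: measurable_uncons_rV => //.
  exact: measurableX.
rewrite /cons_measure /pushforward -comp_preimage.
rewrite (_ : uncons_rV \o cons_rV = id); last exact/funext/cons_rVK.
rewrite preimage_id; apply: le_lt_trans (_ : lebesgue_measure (F k) * mu (G k) < _)%E.
  by rewrite product_measure1E.
by rewrite lte_mul_pinfty// ge0_fin_numE.
Qed.

HB.instance Definition _ := Measure_isSigmaFinite.Build _ _ _ cons_measure
  cons_measure_sigma_finite.

End cons_measure.

(* n-dimensional Lebesgue measure on Borel sets, as the iterated product of
   [lebesgue_measure]; see [borel_lebesgue_box]. *)
Fixpoint borel_lebesgue (R : realType) (n : nat) :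
    {sigma_finite_measure set 'rV[R]_n -> \bar R} :=
  match n with
  | 0 => \d_(0 : 'rV[R]_0)
  | m.+1 => cons_measure (borel_lebesgue R m)
  end.

Section box.
Context {R : realType}.
Definition box_rV (n : nat) (A : 'I_n -> set R) : set 'rV[R]_n :=
  [set x | forall i, A i (x ord0 i)].

Lemma measurable_box_rV n (A : 'I_n -> set R) :
  (forall i, measurable (A i)) -> measurable (box_rV A).
Proof.
move=> mA; rewrite (_ : box_rV A =
    \bigcap_(i in [set: 'I_n]) ((fun v : 'rV[R]_n => v ord0 i) @^-1` A i)).
  apply: fin_bigcap_measurable => [|i _]; first exact: finite_finset.
  by rewrite -[X in measurable X]setTI; exact: measurable_rV_coord.
by apply/seteqP; split=> [v h i _|v h i]; [exact: h|exact: (h i I)].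
Qed.

Lemma borel_lebesgue_box (n : nat) (A : 'I_n -> set R) :
  (forall i, measurable (A i)) ->
  borel_lebesgue R n (box_rV A) = (\prod_(i < n) lebesgue_measure (A i))%E.
Proof.
elim: n A => [|n IHn] A mA.
  rewrite big_ord0 (_ : box_rV A = setT) ?diracT//.
    by rewrite /= diracE mem_set.
  by apply/seteqP; split=> // x _ [].
rewrite big_ord_recl.
rewrite -[LHS]/((lebesgue_measure \x borel_lebesgue R n)%E
  (@cons_rV R n @^-1` box_rV A)).
rewrite (_ : cons_rV (n:=n) @^-1` _ = (A ord0 : set (measurableTypeR R)) `*`
    box_rV (fun i => A (lift ord0 i))).
  rewrite product_measure1E ?IHn//; first exact: mA.
  by apply: measurable_box_rV.
apply/seteqP; split=> [[t v] /= h|[t v] /= [h0 h] i].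
  split; first by have := h ord0; rewrite cons_rV0.
  by move=> i; have := h (lift ord0 i); rewrite cons_rVS.
by case: (unliftP ord0 i) => [j|] ->; rewrite ?cons_rV0 ?cons_rVS; [exact: h|].
Qed.
End box.

(* R and R^n with the sigma-algebra of Lebesgue measurable sets: the Caratheodory
   sets of the outer measure induced by length, resp. by [borel_lebesgue]. The
   points are those of [R] and ['rV[R]_n]. *)
Definition lebR (R : realType) : measurableType _ :=
  caratheodory_type (@wlength R idfun)^*%mu.

Definition lebRn (R : realType) (n : nat) : measurableType _ :=
  caratheodory_type (borel_lebesgue R n)^*%mu.

(* The completed n-dimensional Lebesgue measure. As a set function it is the
   Lebesgue outer measure, so it makes sense on every set. *)
Definition lebesgue (R : realType) (n : nat) : set (lebRn R n) -> \bar R :=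
  @completed_measure_extension _ _ _ (borel_lebesgue R n).

HB.instance Definition _ (R : realType) (n : nat) :=
  Measure.on (@lebesgue R n).

Arguments lebesgue {R n}.

(* The Euclidean norm; [`|x|] on ['rV[R]_n] is the sup norm. *)
Definition enorm (R : realType) (n : nat) (x : 'rV[R]_n) : R :=
  Num.sqrt (\sum_(i < n) x ord0 i ^+ 2).

Section joint_law.
Context (d d1 d2 : measure_display) (Omega : measurableType d) (R : realType).
Context (T1 : measurableType d1) (T2 : measurableType d2).
Variables (P : probability Omega R) (X : {RV P >-> T1}) (Y : {RV P >-> T2}).

Definition pair_RV (w : Omega) : T1 * T2 := (X w, Y w).

Let measurable_pair_RV : measurable_fun setT pair_RV.
Proof. exact: measurable_fun_pair. Qed.

HB.instance Definition _ :=
  isMeasurableFun.Build _ _ Omega (T1 * T2)%type pair_RV measurable_pair_RV.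

Definition joint_law : probability (T1 * T2)%type R := distribution P pair_RV.

End joint_law.

(* R^(n+1) is identified with R * R^n. *)
Definition cvg_weakly_dirac (R : realType) (n : nat)
    (Pi : nat -> probability (R * 'rV[R]_n)%type R) (a : R * 'rV[R]_n) : Prop :=
  forall g : R * 'rV[R]_n -> R, continuous g -> bounded_fun g ->
    (\int[Pi j]_p (g p)%:E)%E @[j --> \oo] --> (g a)%:E.

(* The positive integers are the [j : nat] with [1 <= j]; index 0 plays no role.
   [phi] represents a function on the open half-line: its value at 0 only enters
   at the single point z = x - y_j, a null set as soon as n >= 1, and its values
   at negative reals never enter. Integrals, hence expectations, take values in
   the extended reals. *)
Section operators.
Context (d : measure_display) (Omega : measurableType d) (R : realType) (n : nat).
Variables (P : probability Omega R) (phi : R -> R).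
Variables (eps : nat -> Omega -> R) (y : nat -> Omega -> 'rV[R]_n).
Implicit Types (f : lebRn R n -> R) (x : lebRn R n).
Local Open Scope ereal_scope.

Definition mean_op (j : nat) f x : \bar R :=
  \int[P]_w (((eps j w ^+ n)^-1)%:E *
    \int[lebesgue]_z (phi (enorm (x - z - y j w) / eps j w) * f z)%:E).

Definition maximal_op f x : \bar R :=
  ereal_sup [set \int[P]_w \int[lebesgue]_z
      ((eps j w ^+ n)^-1 * phi (enorm (x - y j w - z) / eps j w) * `|f z|)%:E
    | j in [set j | (1 <= j)%N]].

End operators.

Definition weak_type_11 (R : realType) (n : nat)
    (M : (lebRn R n -> R) -> lebRn R n -> \bar R) : Prop :=
  exists2 A : R, 0 < A &
    forall (lam : R) (f : lebRn R n -> R), 0 < lam ->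
      lebesgue.-integrable [set: lebRn R n] (EFin \o f) ->
      (lebesgue [set x | lam%:E < M f x] <=
        (A / lam)%:E * \int[lebesgue]_x `|f x|%:E)%E.

(* Main.v *)
Require Import Defs.
From HB Require Import structures.
From mathcomp Require Import all_boot all_order all_algebra.
From mathcomp Require Import all_classical all_reals all_analysis.
From mathcomp Require Import measurable_realfun ring lra.

Set Implicit Arguments.
Unset Strict Implicit.
Unset Printing Implicit Defensive.

Import Order.TTheory GRing.Theory Num.Theory.
Import numFieldNormedType.Exports.

Local Open Scope classical_set_scope.
Local Open Scope ring_scope.

(** The theorem follows the classical scheme: convergence on a dense class, plus a
    weak type bound on the maximal operator.

    For a bounded continuous function g, the substitution z = x - y + eps u turns
    the inner integral into G(eps, y), the integral over u of
    phi(|u|) g(x - y + eps u). By dominated convergence G is bounded and continuous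
    on R * R^n, and G(0, 0) = g x since the kernel has mass 1. The mean of g is the
    integral of G against the joint law of (eps_j, y_j), so weak convergence to the
    Dirac mass gives the limit g x at every point x ([average_continuous],
    [mean_op_test_cvg]).

    For a general integrable f, choose such a g close to f in L1
    ([L1_approx_integrable]). Where the maximal function of f - g and |f - g| are both
    at most l, the means of f are eventually within 3 l of f x ([mean_op_close]). The
    weak type inequality and Markov's inequality bound the measure of the remaining
    points by (A / l + 1 / l) times the L1 distance from f to g, which is arbitrarily
    small. So the points where the means are not eventually within 3 l of f x form a
    null set for each l, and countably many values of l suffice.

    Tonelli's theorem is needed on Omega * R^n with Borel data, whereas phi and f are
    only Lebesgue measurable. Both are replaced by Borel functions off null sets
    ([borel_off_null], [integral_lebesgue_off_null]). For phi this requires that the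
    norm pulls null sets of the half-line back to null sets of R^n, proved by
    averaging over dilations ([enorm_preimage_null]). *)

(** * Completed sigma-algebras: Borel versions off a null set *)

Section completion.
Context d (T : measurableType d) (R : realType).
Local Open Scope ereal_scope.

(** Intersecting covers whose total masses approach the infimum defining the
    outer measure gives a measurable superset that attains it. *)
Lemma measurable_hull (mu : {measure set T -> \bar R}) (A : set T) :
  exists B, [/\ measurable B, A `<=` B & mu B = (mu^*)%mu A].
Proof.
have [Aoo|Aoo] := eqVneq ((mu^*)%mu A) +oo.
  exists setT; split => //; apply/eqP; rewrite Aoo -leye_eq -Aoo.
  by rewrite -(measurable_mu_extE mu)//; exact: le_outer_measure.
have Afin : (mu^*)%mu A \is a fin_num.
  by rewrite ge0_fin_numE ?outer_measure_ge0// ltey.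
have inv0 k : (0 < k.+1%:R^-1 :> R)%R by rewrite invr_gt0.
have cover k : exists B, [/\ measurable B, A `<=` B &
    mu B <= (mu^*)%mu A + (k.+1%:R^-1)%:E].
  have [_ [F [mF AF] <-] Flt] := lb_ereal_inf_adherent (inv0 k) Afin.
  exists (\bigcup_i F i); split => //; first exact: bigcupT_measurable.
  apply: le_trans (ltW Flt).
  by apply: measure_sigma_subadditive => //; exact: bigcupT_measurable.
have [B BP] := choice cover.
have mB : measurable (\bigcap_k B k).
  by apply: bigcapT_measurable => k; case: (BP k).
have AB : A `<=` \bigcap_k B k by apply: sub_bigcap => k _; case: (BP k).
exists (\bigcap_k B k); split => //.
apply/eqP; rewrite eq_le; apply/andP; split; last first.
  by rewrite -(measurable_mu_extE mu)//; exact: le_outer_measure.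
apply/lee_addgt0Pr => e e0; near \oo => k.
have [mBk _ muBk] := BP k.
apply: (@le_trans _ _ (mu (B k))).
  by apply: le_measure; rewrite ?inE//; exact: bigcap_inf.
apply: (le_trans muBk); rewrite leeD2l// lee_fin ltW//.
by near: k; exact: near_infty_natSinv_lt (PosNum e0).
Unshelve. all: by end_near. Qed.

(** Keeping the null set N explicit and measurable allows countably many
    exceptional sets to be merged into one. *)
Definition eq_off_null (mu : set T -> \bar R) (E : set T) :=
  exists B N, [/\ measurable B, measurable N, mu N = 0 & E `\` N = B `\` N].

(** When E has finite outer measure, the Caratheodory condition tested on a
    measurable hull B of E shows that B minus E has outer measure 0, so it is
    contained in a measurable null set. Sigma-finiteness reduces to this case by
    countable gluing. *)
Lemma caratheodory_eq_off_null (mu : {sigma_finite_measure set T -> \bar R})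
    (E : set T) :
  ((mu^*)%mu).-cara.-measurable E -> eq_off_null mu E.
Proof.
have fin (A : set T) : ((mu^*)%mu).-cara.-measurable A ->
    (mu^*)%mu A < +oo -> eq_off_null mu A.
  move=> cA Aoo; have [B [mB AB muB]] := measurable_hull mu A.
  have [N [mN BAN muN]] := measurable_hull mu (B `\` A).
  exists B, N; split => //.
    have := cA B; rewrite setIidr//=.
    rewrite [X in X = _](measurable_mu_extE mu mB) muB -setDE muN => e.
    have Afin : (mu^*)%mu A \is a fin_num.
      by rewrite ge0_fin_numE ?outer_measure_ge0.
    by rewrite -(addeK ((mu^*)%mu (B `\` A)) Afin) (addeC ((mu^*)%mu (B `\` A))) -e subee.
  apply/seteqP; split=> x [? nN]; split => //; first exact: AB.
  by apply: contrapT => nA; apply: nN; exact: BAN.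
move=> cE; have [F FT Ffin] := sigma_finiteT mu.
have EF i : exists BN : set T * set T, [/\ measurable BN.1, measurable BN.2,
    mu BN.2 = 0 & (E `&` F i) `\` BN.2 = BN.1 `\` BN.2].
  have [mF Foo] := Ffin i.
  have [| |B [N [mB mN muN eqBN]]] := fin (E `&` F i); last by exists (B, N).
  - apply: caratheodory_measurable_setI => //.
    exact: caratheodory_measurable_mu_ext.
  - apply: le_lt_trans Foo; rewrite -[X in _ <= X](measurable_mu_extE mu mF).
    exact: le_outer_measure.
have [BN BNP] := choice EF.
exists (\bigcup_i (BN i).1), (\bigcup_i (BN i).2); split.
- by apply: bigcupT_measurable => i; case: (BNP i).
- by apply: bigcupT_measurable => i; case: (BNP i).
- have mN : measurable (\bigcup_i (BN i).2).
    by apply: bigcupT_measurable => i; case: (BNP i).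
  apply/negligibleP => //; apply: negligible_bigcup => i.
  by have [_ ? ? _] := BNP i; exact/negligibleP.
- apply/seteqP; split=> x [Ex Nx]; split => //.
    have [i _ Fix] : (\bigcup_i F i) x by rewrite -FT.
    exists i => //; have [_ _ _ BNi] := BNP i.
    have : ((E `&` F i) `\` (BN i).2) x.
      by split=> // Nix; apply: Nx; exists i.
    by rewrite BNi => -[].
  case: Ex => i _ Bix; have [_ _ _ BNi] := BNP i.
  have : ((BN i).1 `\` (BN i).2) x by split=> // Nix; apply: Nx; exists i.
  by rewrite -BNi => -[[]].
Qed.

(** The superlevel sets at rational heights determine f, and one null set absorbs
    the exceptional sets of all of them. *)
Lemma borel_off_null (mu : {measure set T -> \bar R}) (f : T -> R) :
  (forall a : R, eq_off_null mu [set x | (a < f x)%R]) ->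
  exists N, [/\ measurable N, mu N = 0 & measurable_fun setT (f \_ (~` N))].
Proof.
move=> fP.
have fP' (q : rat) : exists BN : set T * set T, [/\ measurable BN.1, measurable BN.2,
    mu BN.2 = 0 & [set x | (ratr q < f x)%R] `\` BN.2 = BN.1 `\` BN.2].
  by have [B [N [? ? ? ?]]] := fP (ratr q); exists (B, N).
have [BN BNP] := choice fP'.
(* the rationals are enumerated by their codes; unused codes contribute set0 *)
pose N_ k := if unpickle k is Some q then (BN q).2 else set0.
have mN_ k : measurable (N_ k).
  by rewrite /N_; case: unpickle => // q; case: (BNP q).
have mN : measurable (\bigcup_k N_ k) by exact: bigcupT_measurable.
exists (\bigcup_k N_ k); split => //.
  apply/negligibleP => //; apply: negligible_bigcup => k; apply/negligibleP => //.
  by rewrite /N_; case: unpickle => // q; case: (BNP q).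
have subN q : (BN q).2 `<=` \bigcup_k N_ k.
  move=> x Nx; exists (pickle q); first exact: I.
  by rewrite /N_ (pickleK q).
apply: (measurability _ (RGenOInfty.measurableE R)) => // _ [_ [a ->] <-].
rewrite setTI.
have -> : (f \_ (~` (\bigcup_k N_ k))) @^-1` `]a, +oo[%classic =
    ((\bigcup_(q in [set q : rat | (a < ratr q)%R]) (BN q).1) `\` \bigcup_k N_ k)
    `|` ((\bigcup_k N_ k) `&` [set _ | (a < 0)%R]).
  apply/seteqP; split=> x /=.
    rewrite in_itv/= andbT patchE; case: ifPn => [|/negP].
      rewrite inE/= => nN afx; left; split => //.
      have [q] := rat_in_itvoo afx; rewrite in_itv/= => /andP[aq qf].
      exists q => //; have [_ _ _ e] := BNP q.
      have : ([set x | (ratr q < f x)%R] `\` (BN q).2) x.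
        by split => // Nqx; apply: nN; exact: subN Nqx.
      by rewrite e => -[].
    by rewrite inE/= => /contrapT Nx a0; right.
  rewrite in_itv/= andbT patchE => -[[[q /= aq Bx] nN]|[Nx a0]].
    rewrite mem_set//; have [_ _ _ e] := BNP q.
    have : ((BN q).1 `\` (BN q).2) x.
      by split => // Nqx; apply: nN; exact: subN Nqx.
    by rewrite -e => -[/= qf _]; exact: lt_trans qf.
  by rewrite memNset//=; apply.
apply: measurableU.
  apply: measurableD => //.
  rewrite bigcup_mkcond; apply: bigcupT_measurable_rat => q.
  by case: ifP => // _; case: (BNP q).
apply: measurableI => //.
have [a0|a0] := ltP a 0%R.
  by rewrite (_ : mkset _ = setT)//; apply/seteqP; split.
by rewrite (_ : mkset _ = set0)//; apply/seteqP; split.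
Qed.

End completion.

Definition image_measure d1 d2 (T1 : measurableType d1) (T2 : measurableType d2)
    (R : realType) (mu : {measure set T1 -> \bar R}) (f : T1 -> T2)
    (mf : measurable_fun setT f) : {measure set T2 -> \bar R} :=
  measure_function_pushforward__canonical__measure_function_Measure mu mf.

Lemma ge0_integral_image d1 d2 (T1 : measurableType d1) (T2 : measurableType d2)
    (R : realType) (mu : {measure set T1 -> \bar R}) (f : T1 -> T2)
    (mf : measurable_fun setT f) (g : T2 -> \bar R) :
  measurable_fun setT g -> (forall x, (0 <= g x)%E) ->
  (\int[image_measure mu mf]_x g x = \int[mu]_x g (f x))%E.
Proof. by move=> mg g0; exact: (ge0_integral_pushforward mf). Qed.

Section lebesgue_vs_borel.
Context (R : realType) (n : nat).
Local Open Scope ereal_scope.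
Local Notation mu := (borel_lebesgue R n).

Lemma borel_measurable_lebesgue (A : set 'rV[R]_n) :
  measurable A -> measurable (A : set (lebRn R n)).
Proof. by move=> mA; exact: caratheodory_measurable_mu_ext. Qed.

Lemma measurable_id_lebRn :
  measurable_fun [set: lebRn R n] (id : lebRn R n -> 'rV[R]_n).
Proof. by move=> _ A mA; rewrite setTI; exact: borel_measurable_lebesgue. Qed.

Lemma measurable_fun_lebRn d (T : measurableType d) (f : 'rV[R]_n -> T) :
  measurable_fun [set: 'rV[R]_n] f -> measurable_fun [set: lebRn R n] f.
Proof. by move=> mf; exact: (measurableT_comp mf measurable_id_lebRn). Qed.

Lemma lebesgue_borelE (A : set 'rV[R]_n) : measurable A -> lebesgue A = mu A.
Proof. by move=> mA; exact: (measurable_mu_extE mu mA). Qed.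

Lemma ge0_integral_lebesgueE (f : 'rV[R]_n -> \bar R) :
  measurable_fun [set: 'rV[R]_n] f -> (forall x, 0 <= f x) ->
  \int[lebesgue]_(x in [set: lebRn R n]) f x = \int[mu]_x f x.
Proof.
move=> mf f0.
rewrite -(ge0_integral_image (@lebesgue R n) measurable_id_lebRn mf f0).
apply: (@eq_measure_integral _ _ _ _ mu (image_measure lebesgue measurable_id_lebRn)).
by move=> A mA _; exact: lebesgue_borelE.
Qed.

Lemma integral_lebesgueE (f : 'rV[R]_n -> \bar R) : measurable_fun [set: 'rV[R]_n] f ->
  \int[lebesgue]_(x in [set: lebRn R n]) f x = \int[mu]_x f x.
Proof.
move=> mf; rewrite integralE [RHS]integralE; congr (_ - _).
  by apply: ge0_integral_lebesgueE => //; exact: measurable_funepos.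
by apply: ge0_integral_lebesgueE => //; exact: measurable_funeneg.
Qed.

Lemma lebesgue_is_complete : measure_is_complete (@lebesgue R n).
Proof. exact: measure_is_complete_caratheodory. Qed.

Lemma lebesgue_borel_off_null (f : lebRn R n -> R) :
  measurable_fun [set: lebRn R n] f ->
  exists N, [/\ measurable N, mu N = 0 &
    measurable_fun [set: 'rV[R]_n] (f \_ (~` N))].
Proof.
move=> mf; apply: borel_off_null => a; apply: caratheodory_eq_off_null.
have := mf measurableT `]a, +oo[%classic; rewrite setTI => /(_ _).
rewrite (_ : _ @^-1` _ = [set x | (a < f x)%R]); first by apply.
by apply/seteqP; split => x; rewrite /= in_itv/= andbT.
Qed.

(** By completeness, agreeing with a Borel function off a null set is enough for f
    to be Lebesgue measurable. This is how the Lebesgue measurable data phi and f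
    are exchanged for Borel ones, to which the product sigma-algebras and hence
    Tonelli's theorem apply. *)
Lemma integral_lebesgue_off_null (N : set 'rV[R]_n) (f g : 'rV[R]_n -> \bar R) :
  measurable N -> mu N = 0 -> (forall x, ~ N x -> f x = g x) ->
  measurable_fun [set: 'rV[R]_n] g ->
  \int[lebesgue]_(x in [set: lebRn R n]) f x = \int[mu]_x g x.
Proof.
move=> mN muN fg mg.
have gf : ae_eq (@lebesgue R n) setT g f.
  exists N; split; first exact: borel_measurable_lebesgue.
    by rewrite -muN; exact: lebesgue_borelE.
  by move=> x /=; apply: contra_notP => Nx _; exact/esym/fg.
rewrite -integral_lebesgueE//; apply/esym/ae_eq_integral => //.
  exact: measurable_fun_lebRn.
apply: (ae_measurable_fun lebesgue_is_complete gf).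
exact: measurable_fun_lebRn.
Qed.

End lebesgue_vs_borel.

Lemma lebR_borel_off_null (R : realType) (f : R -> R) :
  measurable_fun (`]0, +oo[%classic : set (lebR R)) f ->
  exists N, [/\ measurable N, lebesgue_measure N = 0%E &
    measurable_fun [set: measurableTypeR R] ((f \_ `]0, +oo[) \_ (~` N))].
Proof.
move=> mf.
have m0 : measurable (`]0, +oo[%classic : set (lebR R)).
  by apply: sub_caratheodory; exact: measurable_itv.
have {}mf : measurable_fun [set: lebR R] (f \_ `]0, +oo[).
  exact: ((@measurable_restrictT _ _ (lebR R) _ _ f m0).1 mf).
apply: borel_off_null => a.
pose E := [set x : R | a < (f \_ `]0, +oo[) x].
have : ((@wlength R idfun)^*%mu).-cara.-measurable E.
  have := mf measurableT `]a, +oo[%classic (measurable_itv _); rewrite setTI.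
  rewrite (_ : _ @^-1` _ = E)//.
  by apply/seteqP; split => x; rewrite /E/= in_itv/= andbT.
rewrite -completed_caratheodory_measurable g_sigma_completed_algebra_genE.
move=> [A mA [M [N [mN muN MN]] AM]].
exists A, N; split => //; rewrite -/E -AM.
apply/seteqP; split => x [] ; first by move=> [Ax|/MN].
by move=> Ax nN; split => //; left.
Qed.

(** * Affine changes of variable *)

Section affine.
Context (R : realType).
Local Open Scope ereal_scope.

Lemma measurable_affine (c e : R) :
  measurable_fun [set: measurableTypeR R]
    (fun t : measurableTypeR R => (c + e * t)%R : measurableTypeR R).
Proof. by apply: measurable_funD => //; exact: mulrl_measurable. Qed.

(** Both sides are measures in A, so agreement on bounded intervals suffices. *)
Lemma lebesgue_measure_affine (c e : R) (e0 : (0 < e)%R) (A : set (measurableTypeR R)) :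
  measurable A ->
  lebesgue_measure A = e%:E * lebesgue_measure ((fun t => c + e * t)%R @^-1` A).
Proof.
pose nu := mscale (NngNum (ltW e0))
  (image_measure lebesgue_measure (measurable_affine c e)).
move=> mA; apply: (@lebesgue_measure_unique R nu) => // _ [[a b] _ <-].
rewrite lebesgue_measure_itv/= /nu/= /mscale/= /pushforward.
have -> : (fun t => c + e * t)%R @^-1` `]a, b]%classic =
    [set` `](a - c) / e, (b - c) / e]%R].
  apply/seteqP; split => t /=; rewrite !in_itv/= ltr_pdivrMr// ler_pdivlMr//.
    by rewrite mulrC ltrBlDl lerBrDl.
  by rewrite mulrC ltrBlDl lerBrDl.
rewrite lebesgue_measure_itv/= !lte_fin ltr_pM2r ?invr_gt0// ltrD2r.
case: ifPn => _; last by rewrite mule0.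
rewrite -!EFinB -EFinM; congr (_%:E).
by rewrite -mulrBl mulrC divfK ?gt_eqF// opprB addrA subrK.
Qed.

Lemma ge0_integral_affine1 (c e : R) (f : measurableTypeR R -> \bar R) : (0 < e)%R ->
  measurable_fun setT f -> (forall x, 0 <= f x) ->
  \int[lebesgue_measure]_x f x = e%:E * \int[lebesgue_measure]_t f (c + e * t)%R.
Proof.
move=> e0 mf f0.
rewrite -(ge0_integral_image lebesgue_measure (measurable_affine c e) mf f0).
rewrite -(ge0_integral_mscale _ _ (NngNum (ltW e0)))//.
apply: (@eq_measure_integral _ _ _ _ (mscale (NngNum (ltW e0))
  (image_measure lebesgue_measure (measurable_affine c e)))).
by move=> A mA _; exact: (lebesgue_measure_affine c e0 mA).
Qed.

Lemma ge0_integral_cons n (f : 'rV[R]_n.+1 -> \bar R) :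
  measurable_fun setT f -> (forall x, 0 <= f x) ->
  \int[borel_lebesgue R n.+1]_x f x =
  \int[lebesgue_measure]_t \int[borel_lebesgue R n]_v f (cons_rV (t, v)).
Proof.
move=> mf f0.
rewrite -(fubini_tonelli1 (fun p => f (cons_rV p)))//.
  exact: (ge0_integral_image (lebesgue_measure \x borel_lebesgue R n)
    (@measurable_cons_rV R n) mf f0).
exact: (measurableT_comp mf (@measurable_cons_rV R n)).
Qed.

Lemma measurable_affine_rV n (c : 'rV[R]_n) (e : R) :
  measurable_fun [set: 'rV[R]_n] (fun u => (c + e *: u)%R).
Proof.
apply/measurable_fun_rVP => i; under eq_fun do rewrite !mxE.
apply: measurable_funD => //; apply: measurable_funM => //.
exact: measurable_rV_coord.
Qed.

(** Induction on the dimension: slicing along the first coordinate, the remaining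
    coordinates are handled by induction and the first one by the case of the
    line. *)
Lemma ge0_integral_affine n (c : 'rV[R]_n) (e : R) (f : 'rV[R]_n -> \bar R) :
  (0 < e)%R -> measurable_fun setT f -> (forall x, 0 <= f x) ->
  \int[borel_lebesgue R n]_x f x =
  (e ^+ n)%:E * \int[borel_lebesgue R n]_u f (c + e *: u)%R.
Proof.
move=> e0; elim: n c f => [|n IHn] c f mf f0.
  rewrite expr0 mul1e; apply: eq_integral => x _; congr (f _).
  by apply/rowP => -[].
have mfa : measurable_fun [set: 'rV[R]_n.+1] (fun u => f (c + e *: u)%R).
  exact: (measurableT_comp mf (measurable_affine_rV c e)).
rewrite [in RHS]ge0_integral_cons//.
pose c' := (uncons_rV c).2.
have consE t v : (c + e *: cons_rV (t, v))%R =
    cons_rV ((c ord0 ord0 + e * t)%R, (c' + e *: v)%R).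
  apply/rowP => j; rewrite mxE [X in (_ + X)%R]mxE; case: (unliftP ord0 j) => [i|] ->.
    by rewrite !cons_rVS !mxE.
  by rewrite !cons_rV0.
have mfc : measurable_fun setT (f \o @cons_rV R n).
  exact: (measurableT_comp mf (@measurable_cons_rV R n)).
have mfct t : measurable_fun setT (fun v => f (cons_rV (t, v))).
  exact: (measurableT_comp mfc (measurable_pair1 t)).
pose g (t : measurableTypeR R) := \int[borel_lebesgue R n]_v f (cons_rV (t, v)).
have mg : measurable_fun setT g.
  by apply: (measurable_fun_fubini_tonelli_F (f \o @cons_rV R n)) => // x; exact: f0.
have g0 t : 0 <= g t by apply: integral_ge0.
rewrite ge0_integral_cons// (ge0_integral_affine1 (c ord0 ord0) e0 mg g0).
under eq_integral => t _.
  rewrite /g (IHn c' _ (mfct _))//.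
  over.
have mg' : measurable_fun setT (fun t => \int[borel_lebesgue R n]_v f (c + e *: cons_rV (t, v))%R).
  apply: (measurable_fun_fubini_tonelli_F (fun p => f (c + e *: cons_rV p)%R)) => //.
  exact: (measurableT_comp mfa (@measurable_cons_rV R n)).
rewrite (_ : (fun _ => _) = (fun t => (e ^+ n)%:E *
    \int[borel_lebesgue R n]_v f (c + e *: cons_rV (t, v))%R)); last first.
  apply/funext => t; congr (_ * _); apply: eq_integral => v _.
  by rewrite consE.
rewrite ge0_integralZl//; last 2 first.
  by move=> t _; exact: integral_ge0.
  by rewrite lee_fin exprn_ge0// ltW.
by rewrite muleA -EFinM -exprS.
Qed.

Lemma pmuleBr (r : R) (x y : \bar R) : (0 < r)%R ->
  r%:E * (x - y) = r%:E * x - r%:E * y.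
Proof.
move=> r0; case: x => [x| |]; case: y => [y| |] //=;
  rewrite ?(gt0_muley, gt0_muleNy, lte_fin)//.
by rewrite -EFinD -!EFinM -EFinD mulrBr.
Qed.

(** The positive and negative parts scale by the same positive factor, which
    distributes over their difference even when both are infinite. *)
Lemma integral_affine n (c : 'rV[R]_n) (e : R) (f : 'rV[R]_n -> \bar R) :
  (0 < e)%R -> measurable_fun setT f ->
  ((e ^+ n)^-1)%:E * \int[borel_lebesgue R n]_x f x =
  \int[borel_lebesgue R n]_u f (c + e *: u)%R.
Proof.
move=> e0 mf.
have en0 : (0 < (e ^+ n)^-1)%R by rewrite invr_gt0 exprn_gt0.
rewrite integralE [RHS]integralE pmuleBr//.
have en (x : \bar R) : ((e ^+ n)^-1)%:E * ((e ^+ n)%:E * x) = x.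
  by rewrite muleA -EFinM mulVf ?mul1e// gt_eqF// exprn_gt0.
congr (_ - _).
  rewrite (ge0_integral_affine c e0 (measurable_funepos mf))// en.
  by apply: eq_integral => u _; rewrite !funeposE.
rewrite (ge0_integral_affine c e0 (measurable_funeneg mf))// en.
by apply: eq_integral => u _; rewrite !funenegE.
Qed.


End affine.

(** * Radial functions *)

Section radial.
Context (R : realType) (n : nat).
Local Open Scope ereal_scope.
Local Notation mu := (borel_lebesgue R n).

Lemma measurable_enorm : measurable_fun [set: 'rV[R]_n] (@enorm R n).
Proof.
apply: measurableT_comp.
  by apply: continuous_measurable_fun => x; exact: sqrt_continuous.
apply: measurable_sum => i; apply: measurable_funX.
exact: measurable_rV_coord.
Qed.

Lemma enorm_ge0 (x : 'rV[R]_n) : (0 <= enorm x)%R.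
Proof. exact: sqrtr_ge0. Qed.

Lemma enormZ (t : R) (x : 'rV[R]_n) : (0 <= t)%R -> enorm (t *: x) = (t * enorm x)%R.
Proof.
move=> t0; rewrite /enorm; under eq_bigr do rewrite mxE exprMn.
by rewrite -big_distrr/= sqrtrM ?sqr_ge0// sqrtr_sqr ger0_norm.
Qed.

Lemma enorm_eq0 (x : 'rV[R]_n) : (enorm x == 0)%R = (x == 0)%R.
Proof.
apply/eqP/eqP => [|->]; last first.
  by rewrite /enorm big1 ?sqrtr0// => i _; rewrite mxE expr0n.
move/eqP; rewrite sqrtr_eq0 => s0; apply/rowP => i; rewrite mxE.
apply/eqP; rewrite -sqrf_eq0 eq_le sqr_ge0 andbT.
apply: le_trans s0; rewrite (bigD1 i)//= lerDl sumr_ge0// => j _.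
exact: sqr_ge0.
Qed.

(** Averaging over dilations replaces polar coordinates. For fixed x the set of t
    with t |x| in N is null, so Tonelli's theorem makes the integral over t in
    [1, 2] of the measure of {x | t |x| in N} vanish. That measure is t^-n times the
    measure of {x | |x| in N}, hence at least 2^-n times it. *)
Lemma enorm_preimage_null (N : set (measurableTypeR R)) :
  measurable N -> lebesgue_measure N = 0 -> ~ N 0%R ->
  mu (@enorm R n @^-1` N) = 0.
Proof.
move=> mN N0 nN0.
have mindN : measurable_fun setT (\1_N : measurableTypeR R -> R) by exact: measurable_indic.
have mE : measurable (@enorm R n @^-1` N).
  by rewrite -[X in measurable X]setTI; exact: measurable_enorm.
pose I12 : set (measurableTypeR R) := `[1%R, 2%R]%classic.
have mI12 : measurable I12 by exact: measurable_itv.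
pose h (p : measurableTypeR R * 'rV[R]_n) : \bar R :=
  (\1_I12 p.1 * \1_N (p.1 * enorm p.2)%R)%:E.
have h0 p : 0 <= h p by rewrite lee_fin mulr_ge0.
have mh : measurable_fun setT h.
  apply/measurable_EFinP; apply: measurable_funM.
    exact: (measurableT_comp (measurable_indic mI12) measurable_fst).
  apply: (measurableT_comp mindN); apply: measurable_funM.
    exact: measurable_fst.
  exact: (measurableT_comp measurable_enorm measurable_snd).
have hx (x : 'rV[R]_n) : \int[lebesgue_measure]_t h (t, x) = 0.
  apply/eqP; rewrite eq_le; apply/andP; split; last first.
    by apply: integral_ge0 => t _; exact: h0.
  have [x0|x0] := eqVneq (enorm x) 0%R.
    rewrite integral0_eq// => t _; rewrite /h/= x0 mulr0 [X in (_ * X)%R]indicE memNset//.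
    by rewrite mulr0.
  have {}x0 : (0 < enorm x)%R by rewrite lt_def x0 enorm_ge0.
  have mN' : measurable_fun setT (fun t : measurableTypeR R => (\1_N (0 + enorm x * t)%R : R)%:E).
    apply/measurable_EFinP; apply: (measurableT_comp mindN).
    exact: measurable_affine.
  have : \int[lebesgue_measure]_t (\1_N t : R)%:E = 0 by rewrite integral_indic// setIT.
  have mNE : measurable_fun setT (fun t : measurableTypeR R => (\1_N t : R)%:E).
    exact/measurable_EFinP.
  have NE0 (t : measurableTypeR R) : 0 <= (\1_N t : R)%:E by rewrite lee_fin.
  rewrite (ge0_integral_affine1 0%R x0 mNE NE0).
  move=> /eqP; rewrite mule_eq0 eqe gt_eqF//= => /eqP <-.
  apply: ge0_le_integral => //.
  - exact: (measurableT_comp mh (measurable_pair2 x)).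
  - move=> t _; rewrite lee_fin add0r/= [(enorm x * t)%R]mulrC.
    by rewrite ler_piMl// indicE; case: (_ \in _).
have J12 t : I12 t ->
    mu (@enorm R n @^-1` N) <= (2 ^+ n)%:E * \int[mu]_x h (t, x).
  rewrite /I12/= in_itv/= => /andP[t1 t2].
  have t0 : (0 < t)%R by exact: lt_le_trans t1.
  rewrite -[X in mu X]setIT -integral_indic//.
  rewrite (ge0_integral_affine 0%R t0); last 2 first.
  - by apply/measurable_EFinP; exact: measurable_indic.
  - by move=> x; rewrite lee_fin.
  rewrite [X in _ * X <= _](_ : _ = \int[mu]_x h (t, x)).
    rewrite lee_wpmul2r//; first exact: integral_ge0.
    by rewrite lee_fin lerXn2r// nnegrE ltW// (lt_le_trans t0).
  apply: eq_integral => x _; rewrite /h/= [X in (X * _)%R]indicE mem_set ?mul1r.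
    by rewrite add0r !indicE -enormZ ?ltW.
  by rewrite /I12/= in_itv/= t1.
apply/eqP; rewrite eq_le measure_ge0 andbT.
have <- : (2 ^+ n)%:E * \int[lebesgue_measure]_t \int[mu]_x h (t, x) = 0.
  by rewrite (fubini_tonelli h)// integral0_eq ?mule0.
have mH : measurable_fun setT (fun t => \int[mu]_x h (t, x)).
  exact: (measurable_fun_fubini_tonelli_F h).
rewrite -ge0_integralZl//; last by move=> t _; exact: integral_ge0.
rewrite [leLHS](_ : _ = \int[lebesgue_measure]_(t in I12) mu (@enorm R n @^-1` N)).
  rewrite [leLHS]integral_mkcond. apply: ge0_le_integral => //.
  - by move=> t _; rewrite patchE; case: ifP.
  - by apply/(measurable_restrictT _ mI12).
  - by apply: emeasurable_funM.
  - move=> t _; rewrite patchE; case: ifPn => [|_].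
      by rewrite inE; exact: J12.
    by rewrite mule_ge0 ?integral_ge0// lee_fin exprn_ge0.
rewrite integral_cst// [X in _ * X](lebesgue_measure_itv `[1%R, 2%R]%R)/= lte_fin ltr1n/= -EFinB.
by rewrite (_ : 2 - 1 = 1)%R ?mule1//; apply/eqP; rewrite subr_eq.
Qed.

Lemma borel_lebesgue_origin : (1 <= n)%N -> mu [set 0%R] = 0.
Proof.
move=> n1; rewrite (_ : [set 0%R] = box_rV (fun _ : 'I_n => [set 0%R])); last first.
  apply/seteqP; split => [x -> i /=|x x0 /=]; first by rewrite mxE.
  by apply/rowP => i; rewrite mxE; exact: x0.
rewrite borel_lebesgue_box//.
case: n n1 => // m _; rewrite big_ord_recl.
by rewrite [X in X * _](lebesgue_measure_set1 0%R) mul0e.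
Qed.

Definition borel_kernel_version (phi psi : R -> R) (Z : set 'rV[R]_n) : Prop :=
  [/\ measurable_fun [set: measurableTypeR R] psi,
    forall t : R, (0 <= psi t)%R, measurable Z, mu Z = 0 &
    forall x, ~ Z x -> phi (enorm x) = psi (enorm x)].

(** The profile phi is only Lebesgue measurable on the half-line and arbitrary at 0.
    Both defects are confined to a null set of R^n: the preimage under the norm of
    a null set of the half-line, together with the origin. *)
Lemma radial_borel_version (phi : R -> R) : (1 <= n)%N ->
  (forall t : R, (0 < t)%R -> (0 <= phi t)%R) ->
  measurable_fun (`]0%R, +oo[%classic : set (lebR R)) phi ->
  exists (psi : R -> R) (Z : set 'rV[R]_n), borel_kernel_version phi psi Z.
Proof.
move=> n1 phi0 /lebR_borel_off_null[N [mN N0 mpsi]].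
pose N' : set (measurableTypeR R) := N `&` `]0%R, +oo[%classic.
have mN' : measurable N' by apply: measurableI => //; exact: measurable_itv.
have mE : measurable (@enorm R n @^-1` N').
  by rewrite -[X in measurable X]setTI; exact: measurable_enorm.
have m0 : measurable [set (0%R : 'rV[R]_n)].
  rewrite (_ : [set _] = @enorm R n @^-1` [set 0%R]).
    by rewrite -[X in measurable X]setTI; exact: measurable_enorm.
  apply/seteqP; split => x /= /eqP x0; apply/eqP; first by rewrite enorm_eq0.
  by rewrite -enorm_eq0.
exists ((phi \_ `]0%R, +oo[) \_ (~` N)), ((@enorm R n @^-1` N') `|` [set 0%R]).
split => //.
- move=> t; rewrite patchE; case: ifP => // _; rewrite patchE; case: ifPn => //.
  by rewrite inE/= in_itv/= andbT; exact: phi0.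
- exact: measurableU.
- rewrite null_set_setU//; last exact: borel_lebesgue_origin.
  apply: enorm_preimage_null => //.
    by apply: (subset_measure0 _ mN) => //; exact: subIsetl.
  by rewrite /N'/= in_itv/= ltxx => -[].
- move=> x /not_orP[/= nN' /eqP x0].
  have {}x0 : (0 < enorm x)%R by rewrite lt_def enorm_eq0 x0 enorm_ge0.
  rewrite patchE mem_set/= => [|Nx]; last first.
    by apply: nN'; split=> //=; rewrite in_itv/= x0.
  by rewrite patchE mem_set//= in_itv/= x0.
Qed.

End radial.

(** * Density of continuous functions in L1 *)

Section box_ramps.
Context (R : realType) (n : nat).
Local Notation mu := (borel_lebesgue R n).
Local Notation rV := 'rV[R]_n.

(** The functions for which convergence of the means at every point can be read
    off from the weak convergence of the laws. *)
Definition test_fun (g : rV -> R) : Prop :=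
  [/\ continuous g, measurable_fun [set: rV] g, exists M, forall x, `|g x| <= M &
    mu.-integrable [set: rV] (EFin \o g)].

Definition L1_approx (f : rV -> R) : Prop := forall eta : R, 0 < eta ->
  exists2 g, test_fun g & (\int[mu]_x `|f x - g x|%:E < eta%:E)%E.

(** A trapezoidal bump that decreases in k to the indicator of [a, b], also when
    a > b and the interval is empty; this spares a case distinction when boxes are
    intersected. *)
Definition ramp (a b : R) (k : nat) (s : R) : R :=
  Num.min 1 (Num.max 0 (1 - k.+1%:R * Num.max (a - s) (s - b))).

Lemma ramp_ge0 a b k s : 0 <= ramp a b k s.
Proof. by rewrite /ramp le_min ler01 le_max lexx. Qed.

Lemma ramp_le1 a b k s : ramp a b k s <= 1.
Proof. by rewrite /ramp ge_min lexx. Qed.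

Lemma ramp_in a b k s : a <= s <= b -> ramp a b k s = 1.
Proof.
move=> /andP[as_ sb]; rewrite /ramp; apply/min_idPl; rewrite le_max; apply/orP; right.
by rewrite lerDl oppr_ge0 mulr_ge0_le0// ge_max !subr_le0 as_.
Qed.

Lemma ramp_out a b k s : k.+1%:R^-1 <= Num.max (a - s) (s - b) -> ramp a b k s = 0.
Proof.
move=> h; rewrite /ramp (max_idPl _) ?(min_idPr _)// subr_le0.
by rewrite -ler_pdivrMl// mulr1.
Qed.

Lemma ramp_support a b k s : ramp a b k s != 0 -> a - 1 <= s <= b + 1.
Proof.
apply: contraR; rewrite negb_and -!ltNge => h; apply/eqP/ramp_out.
apply: (@le_trans _ _ 1).
  by rewrite invf_le1// ler1n.
by rewrite le_max; apply/orP; case/orP: h => h; [left|right]; lra.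
Qed.

Lemma ramp_cvg a b s : ~ (a <= s <= b) -> \forall k \near \oo, ramp a b k s = 0.
Proof.
move=> /negP; rewrite negb_and -!ltNge => h.
have d0 : 0 < Num.max (a - s) (s - b) by rewrite lt_max !subr_gt0.
near=> k; apply: ramp_out; apply: ltW.
by near: k; exact: near_infty_natSinv_lt (PosNum d0).
Unshelve. all: by end_near. Qed.

Lemma ramp_continuous a b k : continuous (ramp a b k : R -> R).
Proof.
have cB (f g : R -> R) : continuous f -> continuous g -> continuous (fun s => f s - g s).
  by move=> cf cg s; apply: cvgB; [exact: cf|exact: cg].
have cid : continuous (id : R -> R) by move=> s.
have cc (c : R) : continuous (cst c : R -> R) by move=> s; exact: cvg_cst.
have cm : continuous (fun s : R => Num.max (a - s) (s - b)).
  by apply: max_fun_continuous; apply: cB => //; exact: cc.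
apply: min_fun_continuous; first exact: cc.
apply: max_fun_continuous; first exact: cc.
apply: cB; first exact: cc.
by move=> s; apply: cvgM; [exact: cvg_cst|exact: cm].
Qed.

Lemma continuous_mulR (f g : rV -> R) : continuous f -> continuous g ->
  continuous (fun x => f x * g x).
Proof. by move=> cf cg x; apply: continuousM; [exact: cf|exact: cg]. Qed.

Lemma continuous_addR (f g : rV -> R) : continuous f -> continuous g ->
  continuous (fun x => f x + g x).
Proof. by move=> cf cg x; apply: continuousD; [exact: cf|exact: cg]. Qed.

Definition box_ramp (a b : 'I_n -> R) (k : nat) (x : rV) : R :=
  \prod_(i < n) ramp (a i) (b i) k (x ord0 i).

Definition cbox (a b : 'I_n -> R) : set rV := box_rV (fun i => `[a i, b i]%classic).

Lemma measurable_cbox a b : measurable (cbox a b).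
Proof. by apply: measurable_box_rV => i; exact: measurable_itv. Qed.

Lemma cbox_fin a b : (mu (cbox a b) < +oo)%E.
Proof.
rewrite borel_lebesgue_box => [|i]; last exact: measurable_itv.
rewrite -ge0_fin_numE; last first.
  by elim/big_ind: _ => // x y x0 y0; exact: mule_ge0.
elim/big_ind: _ => // [x y|i _]; first exact: fin_numM.
rewrite [X in X \is a fin_num](lebesgue_measure_itv `[a i, b i])/=.
by case: ifP.
Qed.

Lemma integrable_indic_fin (A : set rV) : measurable A -> (mu A < +oo)%E ->
  mu.-integrable [set: rV] (EFin \o (\1_A : rV -> R)).
Proof.
move=> mA Aoo; apply/integrableP; split.
  by apply/measurable_EFinP; exact: measurable_indic.
rewrite (eq_integral (EFin \o \1_A)) ?integral_indic ?setIT// => x _ /=.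
by rewrite ger0_norm.
Qed.

Lemma box_ramp01 a b k x : 0 <= box_ramp a b k x <= 1.
Proof.
rewrite /box_ramp; elim/big_ind: _ => // [|u v /andP[u0 u1] /andP[v0 v1]|i _].
- by rewrite ler01 lexx.
- by rewrite mulr_ge0//= mulr_ile1.
- by rewrite ramp_ge0 ramp_le1.
Qed.

Lemma measurable_box_ramp a b k : measurable_fun [set: rV] (box_ramp a b k).
Proof.
apply: measurable_prod => i _.
apply: (measurableT_comp _ (@measurable_rV_coord _ _ n i)).
by apply: continuous_measurable_fun; exact: ramp_continuous.
Qed.

Lemma box_ramp_continuous a b k : continuous (box_ramp a b k).
Proof.
pose F r (x : rV) := \prod_(i <- r) ramp (a i) (b i) k (x ord0 i).
suff cF r : continuous (F r) by exact: cF.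
elim: r => [|i r IHr].
  have -> : F [::] = cst 1 by apply/funext => x; rewrite /F big_nil.
  exact: cst_continuous.
have -> : F (i :: r) = (fun x => ramp (a i) (b i) k (x ord0 i) * F r x).
  by apply/funext => x; rewrite /F big_cons.
apply: (@continuous_mulR (fun x : rV => ramp (a i) (b i) k (x ord0 i)) (F r)); last exact: IHr.
move=> x; apply: (@continuous_comp _ _ _ (fun x : rV => x ord0 i) (ramp (a i) (b i) k)).
  exact: coord_continuous.
exact: ramp_continuous.
Qed.

Lemma box_ramp_dom a b k x :
  `|box_ramp a b k x| <= \1_(cbox (fun i => a i - 1) (fun i => b i + 1)) x.
Proof.
have /andP[g0 g1] := box_ramp01 a b k x; rewrite ger0_norm// indicE.
case: (boolP (x \in _)) => //; rewrite notin_setE => nx.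
have : exists i, ~ (a i - 1 <= x ord0 i <= b i + 1).
  apply: contrapT => h; apply: nx => i /=; rewrite in_itv/=.
  by apply: contrapT => hi; apply: h; exists i.
move=> [i hi]; rewrite /box_ramp (bigD1 i)//=.
suff -> : ramp (a i) (b i) k (x ord0 i) = 0 by rewrite mul0r.
by apply/eqP; apply: contra_notT hi; exact: ramp_support.
Qed.

Lemma box_ramp_test a b k : test_fun (box_ramp a b k).
Proof.
split; first exact: box_ramp_continuous.
- exact: measurable_box_ramp.
- by exists 1 => x; have /andP[g0 g1] := box_ramp01 a b k x; rewrite ger0_norm.
- apply: le_integrable (integrable_indic_fin (measurable_cbox _ _) (cbox_fin _ _)) => //.
    by apply/measurable_EFinP; exact: measurable_box_ramp.
  by move=> x _; rewrite /= lee_fin [leRHS]ger0_norm//; exact: box_ramp_dom.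
Qed.

Lemma box_ramp_cvg a b x : box_ramp a b k x @[k --> \oo] --> (\1_(cbox a b) x : R).
Proof.
rewrite indicE; case: (boolP (x \in _)) => [|]; rewrite ?inE ?notin_setE => xB.
  apply: cvg_near_cst; apply: nearW => k.
  rewrite /box_ramp big1// => i _; apply: ramp_in.
  by have := xB i; rewrite /= in_itv.
have : exists i, ~ (a i <= x ord0 i <= b i).
  apply: contrapT => h; apply: xB => i /=; rewrite in_itv/=.
  by apply: contrapT => hi; apply: h; exists i.
move=> [i /ramp_cvg hi]; apply: cvg_near_cst; near=> k.
rewrite /box_ramp (bigD1 i)//=.
by rewrite (_ : ramp _ _ _ _ = 0) ?mul0r//; near: k.
Unshelve. all: by end_near. Qed.

Lemma test_fun_lin (f g : rV -> R) (c : R) : test_fun f -> test_fun g ->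
  test_fun (fun x => f x + c * g x).
Proof.
move=> [cf mf [Mf bf] If] [cg mg [Mg bg] Ig]; split.
- apply: (@continuous_addR f (fun x => c * g x)) => //.
  by apply: (@continuous_mulR (cst c) g) => //; exact: cst_continuous.
- by apply: measurable_funD => //; exact: measurable_funM.
- exists (Mf + `|c| * Mg) => x; apply: (le_trans (ler_normD _ _)).
  by rewrite lerD// normrM ler_wpM2l.
- rewrite (_ : _ \o _ = ((EFin \o f) \+ (fun x => c%:E * (EFin \o g) x))%E)//.
  by apply: integrableD => //; exact: integrableZl.
Qed.

Lemma L1_approx_lim (f : rV -> R) : measurable_fun setT f ->
  (forall eta : R, 0 < eta -> exists h, [/\ measurable_fun [set: rV] h, L1_approx h &
    (\int[mu]_x `|f x - h x|%:E < eta%:E)%E]) -> L1_approx f.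
Proof.
move=> mf fh eta eta0.
have eta20 : 0 < eta / 2 by rewrite divr_gt0.
have [h [mh ah fhlt]] := fh _ eta20; have [g tg hglt] := ah _ eta20.
have [_ mg _ _] := tg.
exists g => //; rewrite (splitr eta) EFinD.
apply: le_lt_trans (lteD fhlt hglt).
rewrite -ge0_integralD//; last 2 first.
  by apply/measurable_EFinP; apply: measurableT_comp => //; exact: measurable_funB.
  by apply/measurable_EFinP; apply: measurableT_comp => //; exact: measurable_funB.
apply: ge0_le_integral => //.
- by apply/measurable_EFinP; apply: measurableT_comp => //; exact: measurable_funB.
- by apply/measurable_EFinP; apply: measurable_funD;
    apply: measurableT_comp => //; exact: measurable_funB.
- move=> x _; rewrite -EFinD lee_fin (_ : f x - g x = (f x - h x) + (h x - g x)).
    exact: ler_normD.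
  by rewrite addrA subrK.
Qed.

Lemma L1_approx_lin (f g : rV -> R) (c : R) :
  measurable_fun setT f -> measurable_fun setT g ->
  L1_approx f -> L1_approx g -> L1_approx (fun x => f x + c * g x).
Proof.
move=> mf mg af ag eta eta0.
have eta20 : 0 < eta / 2 by rewrite divr_gt0.
have c0 : 0 < `|c| + 1 by rewrite ltr_wpDl.
have [f' tf ff'] := af _ eta20; have [_ mf' _ _] := tf.
have [g' tg gg'] := ag _ (divr_gt0 eta20 c0); have [_ mg' _ _] := tg.
exists (fun x => f' x + c * g' x); first exact: test_fun_lin.
have mF : measurable_fun setT (fun x => `|f x - f' x|%:E).
  by apply/measurable_EFinP; apply: measurableT_comp => //; exact: measurable_funB.
have mG : measurable_fun setT (fun x => `|g x - g' x|%:E).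
  by apply/measurable_EFinP; apply: measurableT_comp => //; exact: measurable_funB.
have {}gg' : ((`|c| + 1)%:E * \int[mu]_x `|g x - g' x|%:E < (eta / 2)%:E)%E.
  by rewrite -lte_pdivlMl// -EFinM mulrC.
rewrite (splitr eta) EFinD.
apply: le_lt_trans (lteD ff' gg').
rewrite -ge0_integralZl//.
rewrite -ge0_integralD//; last exact: measurable_funeM.
apply: ge0_le_integral => //.
- apply/measurable_EFinP; apply: measurableT_comp => //; apply: measurable_funB.
    by apply: measurable_funD => //; exact: measurable_funM.
  by apply: measurable_funD => //; exact: measurable_funM.
- by apply: emeasurable_funD => //; exact: measurable_funeM.
- move=> x _; rewrite -EFinM -EFinD lee_fin.
  rewrite (_ : _ - _ = (f x - f' x) + c * (g x - g' x)); last first.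
    by rewrite mulrBr opprD addrACA.
  apply: (le_trans (ler_normD _ _)); rewrite lerD2l normrM ler_wpM2r// lerDl.
  exact: ler01.
Qed.

(** Dominated convergence turns dominated pointwise limits into L1 limits. *)
Lemma L1_approx_dom (f_ : nat -> rV -> R) (f : rV -> R) (G : rV -> \bar R) :
  (forall k, measurable_fun setT (f_ k)) -> measurable_fun setT f ->
  (forall x, f_ k x @[k --> \oo] --> f x) ->
  mu.-integrable setT G -> (forall k x, (`|f_ k x|%:E <= G x)%E) ->
  (forall k, L1_approx (f_ k)) -> L1_approx f.
Proof.
move=> mf_ mf f_f IG f_G af; apply: L1_approx_lim => // eta eta0.
have [_ + _] : [/\ mu.-integrable setT (EFin \o f),
  [sequence \int[mu]_x `|(f_ k x)%:E - (f x)%:E|]_k @ \oo --> 0 &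
  [sequence \int[mu]_x ((f_ k x)%:E)]_k @ \oo --> \int[mu]_x (f x)%:E]%E.
  apply: (@dominated_convergence _ _ _ mu setT measurableT
    (fun k x => (f_ k x)%:E) (EFin \o f) G) => //.
  - by move=> k; exact/measurable_EFinP.
  - exact/measurable_EFinP.
  - apply: aeW => x _; apply: cvg_EFin; last exact: f_f.
    exact: nearW.
  - by apply: aeW => x k _; exact: f_G.
move=> /fine_cvgP[fin /cvgrPdist_lt/(_ _ eta0) lt].
near \oo => k; exists (f_ k); split => //.
rewrite (_ : (\int[mu]_x _)%E = (\int[mu]_x `|(f_ k x)%:E - (f x)%:E|)%E); last first.
  by apply: eq_integral => x _; rewrite -EFinB abse_EFin distrC.
have fk : (\int[mu]_x `|(f_ k x)%:E - (f x)%:E|)%E \is a fin_num by near: k.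
have : `|0 - fine (\int[mu]_x `|(f_ k x)%:E - (f x)%:E|)%E| < eta by near: k.
rewrite sub0r normrN ger0_norm; first by rewrite -lte_fin fineK.
by rewrite fine_ge0// integral_ge0.
Unshelve. all: by end_near. Qed.

Lemma L1_approx_cbox a b : L1_approx \1_(cbox a b).
Proof.
pose G := EFin \o (\1_(cbox (fun i => a i - 1) (fun i => b i + 1)) : rV -> R).
apply: (@L1_approx_dom (box_ramp a b) _ G).
- exact: measurable_box_ramp.
- exact: measurable_indic (measurable_cbox a b).
- exact: box_ramp_cvg.
- exact: (integrable_indic_fin (measurable_cbox _ _) (cbox_fin _ _)).
- by move=> k x; rewrite lee_fin; exact: box_ramp_dom.
- move=> k eta eta0; exists (box_ramp a b k); first exact: box_ramp_test.
  by rewrite integral0_eq// => x _; rewrite subrr normr0.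
Qed.

End box_ramps.

Section density.
Context (R : realType) (n : nat).
Local Notation mu := (borel_lebesgue R n).
Local Notation rV := 'rV[R]_n.

Definition orthant (u : 'I_n -> R) : set rV := [set x | forall i, u i <= x ord0 i].

(** A half-space {x | a <= x_i} is the union over k of the orthants whose other
    coordinates are bounded below by -k. Orthants are moreover stable under
    intersection, which prepares for Dynkin's lemma. *)
Lemma measurable_rV_orthant : @measurable _ rV = <<s range orthant >>.
Proof.
apply/seteqP; split; last first.
  apply: smallest_sub; first exact: sigma_algebra_measurable.
  move=> _ [u _ <-]; rewrite (_ : orthant u = box_rV (fun i => `[u i, +oo[%classic)).
    by apply: measurable_box_rV => i; exact: measurable_itv.
  by apply/seteqP; split => x h i; have := h i; rewrite /= in_itv/= andbT.
apply: smallest_sub; first exact: smallest_sigma_algebra.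
rewrite -bigcup_seq => B [i /= _] [C mC <-{B}].
have mi : measurable_fun [set: g_sigma_algebraType (range orthant)]
    (fun x : rV => x ord0 i).
  apply: (measurability _ (RGenCInfty.measurableE R)) => // _ [_ [a ->] <-].
  rewrite setTI (_ : _ @^-1` _ = \bigcup_k
      orthant (fun j => if j == i then a else - k%:R)).
    by apply: bigcupT_measurable => k; apply: sub_sigma_algebra; eexists.
  apply/seteqP; split => [x|x [k _ /(_ i)]]; rewrite /= in_itv/= andbT ?eqxx//.
  move=> ax; pose s := \sum_j `|x ord0 j|.
  have s0 : 0 <= s by apply: sumr_ge0.
  exists (Num.bound s) => // j; case: eqP => [->//|_].
  rewrite lerNl; apply: (@le_trans _ _ s); last exact/ltW/archi_boundP.
  rewrite /s (bigD1 j)//= (le_trans (ler_norm _))// normrN lerDl.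
  by apply: sumr_ge0.
exact: mi.
Qed.

Definition cube (N : nat) : set rV := cbox (fun=> - N%:R) (fun=> N%:R).

Lemma cube_cvg (x : rV) : \forall N \near \oo, cube N x.
Proof.
pose s := \sum_j `|x ord0 j|.
have s0 : 0 <= s by apply: sumr_ge0.
near=> N => i /=; rewrite in_itv/= -ler_norml.
apply: (@le_trans _ _ s).
  by rewrite /s (bigD1 i)//= lerDl; apply: sumr_ge0.
apply: (le_trans (ltW (archi_boundP s0))); rewrite ler_nat.
by near: N; exact: nbhs_infty_ge.
Unshelve. all: by end_near. Qed.

Lemma orthant_cube u N :
  orthant u `&` cube N = cbox (fun i => Num.max (u i) (- N%:R)) (fun=> N%:R).
Proof.
apply/seteqP; split => [x [ux Nx] i|x h].
  by have := Nx i; rewrite /= !in_itv/= ge_max => /andP[-> ->]; rewrite ux.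
split => i; have := h i; rewrite /= !in_itv/= ge_max => /andP[/andP[? ?] ?] //.
by apply/andP.
Qed.

Lemma integrable_cube N : mu.-integrable [set: rV] (EFin \o (\1_(cube N) : rV -> R)).
Proof. exact: (integrable_indic_fin (measurable_cbox _ _) (cbox_fin _ _)). Qed.

(** Dynkin's lemma, starting from orthants: an orthant meets a cube in a box, whose
    indicator is a limit of ramps. Intersecting with a cube keeps the indicators
    integrable, so that complements are differences in L1 and disjoint unions are
    dominated limits of finite sums. *)
Lemma L1_approx_cubeI (N : nat) (E : set rV) : measurable E ->
  L1_approx (\1_(E `&` cube N)).
Proof.
have mK : measurable (cube N) by exact: measurable_cbox.
rewrite measurable_rV_orthant => sE.
apply: (@dynkin_induction _ rV (range orthant)
  [set E | L1_approx (\1_(E `&` cube N))] measurable_rV_orthant) => //=.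
- move=> _ _ [u _ <-] [v _ <-]; exists (fun i => Num.max (u i) (v i)) => //.
  apply/seteqP; split => [x h|x [ux vx] i].
    by split => i; have := h i; rewrite /orthant/= ge_max => /andP[].
  by rewrite ge_max ux vx.
- by rewrite setTI; exact: L1_approx_cbox.
- by move=> _ [u _ <-] /=; rewrite orthant_cube; exact: L1_approx_cbox.
- move=> S mS aS.
  rewrite (_ : \1_(~` S `&` cube N) =
      (fun x => (\1_(cube N) x : R) + (-1) * \1_(S `&` cube N) x)).
    apply: L1_approx_lin; [exact: measurable_indic| |exact: L1_approx_cbox|exact: aS].
    by apply: measurable_indic; exact: measurableI.
  apply/funext => x; rewrite !indicE !in_setI in_setC.
  by case: (x \in S); case: (x \in cube N); rewrite /= ?mulr0 ?mulr1 ?subrr ?addr0.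
- move=> F mF tF aF.
  pose G m := \big[setU/set0]_(k < m) F k.
  have mG m : measurable (G m) by apply: bigsetU_measurable.
  have aG m : L1_approx (\1_(G m `&` cube N)).
    elim: m => [|m IHm].
      rewrite /G big_ord0 set0I => eta eta0.
      (* the zero function, as the difference of a ramp with itself *)
      exists (box_ramp (fun=> 0) (fun=> 0) 0 \- box_ramp (fun=> 0) (fun=> 0) 0).
        rewrite (_ : _ \- _ = fun x => box_ramp (fun=> 0) (fun=> 0) 0 x +
            (-1) * box_ramp (fun=> 0) (fun=> 0) 0 x).
          by apply: test_fun_lin; exact: box_ramp_test.
        by apply/funext => x; rewrite mulN1r.
      by rewrite integral0_eq// => x _; rewrite indic0 /= subrr subr0 normr0.
    rewrite (_ : \1_(_ `&` _) =
        (fun x => (\1_(G m `&` cube N) x : R) + 1 * \1_(F m `&` cube N) x)).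
      apply: L1_approx_lin; [| |exact: IHm|exact: aF].
        by apply: measurable_indic; exact: measurableI.
      by apply: measurable_indic; exact: measurableI.
    apply/funext => x; rewrite !indicE !in_setI mul1r /G big_ord_recr/= in_setU -/(G m).
    have : ~ (x \in G m /\ x \in F m).
      rewrite !inE /G -bigcup_mkord => -[[k /= km Fk] Fm].
      have km' : k = m by apply: (tF k m I I); exists x.
      by rewrite km' ltnn in km.
    case: (x \in G m) => /=; case: (x \in F m) => //= h; case: (x \in cube N);
      rewrite /= ?addr0 ?add0r//.
    by exfalso; apply: h.
  apply: (@L1_approx_dom _ _ (fun m => \1_(G m `&` cube N)) _
      (EFin \o \1_(cube N))) => //.
  + by move=> m; apply: measurable_indic; exact: measurableI.
  + by apply: measurable_indic; apply: measurableI => //; exact: bigcupT_measurable.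
  + move=> x; apply: cvg_near_cst; rewrite !indicE !in_setI.
    case: (boolP (x \in \bigcup_k F k)) => [|]; rewrite ?inE ?notin_setE => Fx.
      case: Fx => k _ Fk; near=> m.
      rewrite indicE in_setI [x \in G m]mem_set// /G -bigcup_mkord; exists k => //=.
      by near: m; exact: nbhs_infty_gt.
    apply: nearW => m; rewrite indicE in_setI [x \in G m]memNset// /G -bigcup_mkord => -[k _ Fk].
    by apply: Fx; exists k.
  + exact: integrable_cube.
  + move=> m x; rewrite /= lee_fin !indicE in_setI ger0_norm//.
    by case: (x \in G m); case: (x \in cube N).
Unshelve. all: by end_near. Qed.

Lemma L1_approx_sum (I : Type) (r : seq I) (c : I -> R) (f : I -> rV -> R) :
  (forall i, measurable_fun setT (f i)) -> (forall i, L1_approx (f i)) ->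
  L1_approx (fun x => \sum_(i <- r) c i * f i x).
Proof.
move=> mf af; elim: r => [|i r IHr].
  rewrite (_ : (fun _ => _) = \1_(set0 `&` cube 0)).
    exact: L1_approx_cubeI.
  by apply/funext => x; rewrite big_nil set0I indic0.
rewrite (_ : (fun _ => _) = (fun x => (\sum_(j <- r) c j * f j x) + c i * f i x)).
  apply: L1_approx_lin => //.
  by apply: measurable_sum => j; exact: measurable_funM.
by apply/funext => x; rewrite big_cons addrC.
Qed.

Import HBSimple.

(** The truncation of a simple function to a cube is a combination of indicators
    of bounded sets, and the truncations converge dominatedly. *)
Lemma L1_approx_sfun (g : {sfun rV >-> R}) :
  mu.-integrable setT (EFin \o g) -> L1_approx g.
Proof.
move=> Ig; apply: (@L1_approx_dom _ _ (fun N x => g x * \1_(cube N) x) _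
  (fun x => `|(g x)%:E|%E)) => //.
- by move=> N; apply: measurable_funM => //; apply: measurable_indic; exact: measurable_cbox.
- move=> x; apply: cvg_near_cst; near=> N.
  by rewrite indicE mem_set ?mulr1//; near: N; exact: cube_cvg.
- exact: integrable_abse.
- move=> N x; rewrite lee_fin normrM ler_piMr// ger0_norm// indicE.
- move=> N; pose s := finmap.enum_fset (fset_set (range g)).
  rewrite (_ : (fun _ => _) = (fun x => \sum_(i < size s)
      s`_i * \1_((g @^-1` [set s`_i]) `&` cube N) x)).
    apply: L1_approx_sum => i.
      by apply: measurable_indic; apply: measurableI => //; exact: measurable_cbox.
    exact: L1_approx_cubeI.
  apply/funext => x; rewrite fimfunEord big_distrl/=.
  by apply: eq_bigr => i _; rewrite indicI mulrA.
Unshelve. all: by end_near. Qed.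

Lemma L1_approx_integrable (f : rV -> R) :
  mu.-integrable setT (EFin \o f) -> L1_approx f.
Proof.
move=> If; have [g [Ig _]] := approximation_sfun_integrable measurableT If.
have mf : measurable_fun setT f by apply/measurable_EFinP; exact: measurable_int If.
move=> /fine_cvgP[fin gf]; apply: L1_approx_lim => // eta eta0.
move/cvgrPdist_lt : gf => /(_ _ eta0) gf.
near \oo => k; exists (g k); split => //.
  by apply: L1_approx_sfun; exact: Ig.
rewrite (_ : (\int[mu]_x _)%E = (\int[mu]_x `|(EFin \o f) x - (g k x)%:E|)%E); last first.
  by apply: eq_integral => x _.
have fk : (\int[mu]_x `|(EFin \o f) x - (g k x)%:E|)%E \is a fin_num by near: k.
have : `|0 - fine (\int[mu]_x `|(EFin \o f) x - (g k x)%:E|)%E| < eta by near: k.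
rewrite sub0r normrN ger0_norm; first by rewrite -lte_fin fineK.
by rewrite fine_ge0// integral_ge0.
Unshelve. all: by end_near. Qed.

End density.

(** * Means of a function against the kernel *)

Lemma measurable_fun_integral d1 d2 (T1 : measurableType d1) (T2 : measurableType d2)
    (R : realType) (m : {sigma_finite_measure set T2 -> \bar R})
    (f : T1 * T2 -> \bar R) : measurable_fun setT f ->
  measurable_fun setT (fun x => \int[m]_y f (x, y))%E.
Proof.
move=> mf.
rewrite (_ : (fun _ => _) =
    (fun x => \int[m]_y f^\+ (x, y) - \int[m]_y f^\- (x, y))%E); last first.
  apply/funext => x; rewrite integralE.
  by congr (_ - _)%E; apply: eq_integral => y _; rewrite ?funeposE ?funenegE.
apply: emeasurable_funB.
  apply: (measurable_fun_fubini_tonelli_F (f^\+)%E) => //.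
  exact: measurable_funepos.
apply: (measurable_fun_fubini_tonelli_F (f^\-)%E) => //.
exact: measurable_funeneg.
Qed.

(** Sequential continuity suffices in a pseudometric space: otherwise the balls of
    radius 1/(k+1) around p contain points whose images stay away from f p. It is
    what dominated convergence along sequences can deliver. *)
Lemma continuous_seq (R : realType) (T : pseudoMetricType R) (f : T -> R) :
  (forall p (u : nat -> T), u k @[k --> \oo] --> p -> f (u k) @[k --> \oo] --> f p) ->
  continuous f.
Proof.
move=> cf p; apply: contrapT => nfp.
have [e He] : exists e : {posnum R}, forall d : {posnum R},
    exists q, ball p d%:num q /\ ~ `|f p - f q| < e%:num.
  apply: contrapT => /forallNP h; apply: nfp; apply/cvgrPdist_lt => e e0.
  have /existsNP[d] := h (PosNum e0).
  move/forallNP => hd; near=> q; apply: contrapT => nq; apply: (hd q); split => //.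
  by near: q; exact: nbhsx_ballx.
have inv0 k : 0 < k.+1%:R^-1 :> R by rewrite invr_gt0.
have [u uP] := choice (fun k => He (PosNum (inv0 k))).
have up : u k @[k --> \oo] --> p.
  apply/cvg_ballP => d d0; near=> k.
  have [+ _] := uP k; apply: le_ball => /=; apply/ltW.
  by near: k; exact: near_infty_natSinv_lt (PosNum d0).
have /cvgrPdist_lt/(_ e%:num (ltac:(by []))) [K _ /(_ K (leqnn K))] := cf p u up.
by have [_] := uP K.
Unshelve. all: by end_near. Qed.

Section radial_kernel.
Context (R : realType) (n : nat).
Local Open Scope ereal_scope.
Local Notation mu := (borel_lebesgue R n).
Local Notation rV := 'rV[R]_n.

Lemma enormN (x : rV) : enorm (- x)%R = enorm x.
Proof. by rewrite /enorm; under eq_bigr do rewrite mxE sqrrN. Qed.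

Lemma null_preimage_affine (Z : set rV) (c : rV) (e : R) : (0 < e)%R ->
  measurable Z -> mu Z = 0 ->
  measurable [set z | Z (e^-1 *: (z - c))%R] /\ mu [set z | Z (e^-1 *: (z - c))%R] = 0.
Proof.
move=> e0 mZ muZ.
have E : [set z | Z (e^-1 *: (z - c))%R] = (fun z => - (e^-1 *: c) + e^-1 *: z)%R @^-1` Z.
  by apply/seteqP; split => z /=; rewrite scalerBr addrC.
have mW : measurable [set z | Z (e^-1 *: (z - c))%R].
  by rewrite E -[X in measurable X]setTI; apply: measurable_affine_rV.
split => //; rewrite -[X in mu X]setIT -integral_indic//.
rewrite (ge0_integral_affine c e0); last 2 first.
- by apply/measurable_EFinP; exact: measurable_indic.
- by move=> x; rewrite lee_fin.
rewrite (eq_integral (fun x => (\1_Z x)%:E)).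
  by rewrite integral_indic// setIT [X in _ * X]muZ mule0.
move=> u _; rewrite !indicE; congr ((_%:R)%:E).
suff -> : ((c + e *: u)%R \in [set z | Z (e^-1 *: (z - c))%R]) = (u \in Z) by [].
have eu : (e^-1 *: (c + e *: u - c))%R = u.
  by rewrite addrAC subrr add0r scalerA mulVf ?scale1r// gt_eqF.
by apply/idP/idP; rewrite !inE/= eu.
Qed.

Context (phi psi : R -> R) (Z : set rV) (HZ : borel_kernel_version phi psi Z).

Lemma measurable_kernel : measurable_fun [set: rV] (fun u => psi (enorm u)).
Proof.
have [mpsi _ _ _ _] := HZ.
exact: (measurableT_comp mpsi (@measurable_enorm R n)).
Qed.


Lemma measurable_kernel_shift (c : rV) (e k : R) (f : rV -> R) :
  measurable_fun [set: rV] f ->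
  measurable_fun [set: rV] (fun z => (k * psi (enorm (e^-1 *: (z - c)%R)) * f z)%:E).
Proof.
move=> mf; apply/measurable_EFinP; apply: measurable_funM => //.
apply: measurable_funM => //; apply: (measurableT_comp measurable_kernel).
under eq_fun do rewrite scalerBr addrC.
exact: measurable_affine_rV.
Qed.

Lemma integral_kernel_borel (c : rV) (e k : R) (f f' : rV -> R) (N : set rV) :
  (0 < e)%R -> measurable N -> mu N = 0 ->
  (forall z, ~ N z -> f z = f' z) -> measurable_fun [set: rV] f' ->
  \int[lebesgue]_(z in [set: lebRn R n]) (k * phi (enorm (c - z)%R / e) * f z)%:E
  = \int[mu]_z (k * psi (enorm (e^-1 *: (z - c)%R)) * f' z)%:E.
Proof.
move=> e0 mN muN ff' mf'; have [mpsi _ mZ muZ phipsi] := HZ.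
have [mW muW] := null_preimage_affine c e0 mZ muZ.
have muWN : mu ([set z | Z (e^-1 *: (z - c))%R] `|` N) = 0 by rewrite null_set_setU.
have enE z : (enorm (c - z)%R / e)%R = enorm (e^-1 *: (z - c)%R).
  by rewrite enormZ ?invr_ge0 ?ltW// -enormN opprB mulrC.
apply: (integral_lebesgue_off_null (measurableU _ _ mW mN) muWN).
  move=> z /not_orP[nZ nN]; rewrite enE (phipsi _ nZ).
  by rewrite (ff' _ nN).
exact: measurable_kernel_shift.
Qed.

Lemma kernel_substK (c : rV) (e : R) (u : rV) : (0 < e)%R ->
  (e^-1 *: (c + e *: u - c))%R = u.
Proof. by move=> e0; rewrite addrAC subrr add0r scalerA mulVf ?scale1r// gt_eqF. Qed.

(** After the substitution z = c + e u the factor e^-n disappears and the kernel no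
    longer depends on the random parameters, which now enter only through the
    argument of f. *)
Lemma mean_inner (c : rV) (e : R) (f f' : rV -> R) (N : set rV) :
  (0 < e)%R -> measurable N -> mu N = 0 ->
  (forall z, ~ N z -> f z = f' z) -> measurable_fun [set: rV] f' ->
  ((e ^+ n)^-1)%:E *
    \int[lebesgue]_(z in [set: lebRn R n]) (phi (enorm (c - z)%R / e) * f z)%:E
  = \int[mu]_u (psi (enorm u) * f' (c + e *: u)%R)%:E.
Proof.
move=> e0 mN muN ff' mf'.
have := integral_kernel_borel c 1%R e0 mN muN ff' mf'.
under eq_integral do rewrite mul1r.
move=> ->; rewrite (integral_affine c e0 (measurable_kernel_shift c e 1 mf')).
by apply: eq_integral => u _; rewrite kernel_substK// mul1r.
Qed.

Lemma maximal_inner (c : rV) (e : R) (f f' : rV -> R) (N : set rV) :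
  (0 < e)%R -> measurable N -> mu N = 0 ->
  (forall z, ~ N z -> f z = f' z) -> measurable_fun [set: rV] f' ->
  (forall z, (0 <= f' z)%R) ->
  \int[lebesgue]_(z in [set: lebRn R n])
     ((e ^+ n)^-1 * phi (enorm (c - z)%R / e) * f z)%:E
  = \int[mu]_u (psi (enorm u) * f' (c + e *: u)%R)%:E.
Proof.
move=> e0 mN muN ff' mf' f'0; have [mpsi psi0 _ _ _] := HZ.
rewrite (integral_kernel_borel c (e ^+ n)^-1%R e0 mN muN ff' mf').
have m1 := measurable_kernel_shift c e 1 mf'.
rewrite (eq_integral (fun z : rV => ((e ^+ n)^-1)%:E *
    (1 * psi (enorm (e^-1 *: (z - c)%R)) * f' z)%:E)); last first.
  by move=> z _; rewrite mul1r -EFinM mulrA.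
rewrite ge0_integralZl//; last 2 first.
- by move=> z _; rewrite lee_fin mul1r mulr_ge0.
- by rewrite lee_fin invr_ge0 exprn_ge0// ltW.
rewrite (integral_affine c e0 m1).
by apply: eq_integral => u _; rewrite kernel_substK// mul1r.
Qed.

Lemma measurable_shift d (T : measurableType d) (x : rV) (E : T -> R) (Y : T -> rV) :
  measurable_fun setT E -> measurable_fun [set: T] Y ->
  measurable_fun [set: T * rV] (fun q => x - Y q.1 + E q.1 *: q.2)%R.
Proof.
move=> mE mY; apply/measurable_fun_rVP => i; under eq_fun do rewrite !mxE.
apply: measurable_funD; first apply: measurable_funB => //.
- exact: (measurableT_comp (measurableT_comp (@measurable_rV_coord _ _ n i) mY) measurable_fst).
- apply: measurable_funM; first exact: (measurableT_comp mE measurable_fst).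
  exact: (measurableT_comp (@measurable_rV_coord _ _ n i) measurable_snd).
Qed.

Lemma measurable_kernel_mul d (T : measurableType d) (x : rV) (E : T -> R) (Y : T -> rV)
    (f : rV -> R) :
  measurable_fun setT E -> measurable_fun [set: T] Y -> measurable_fun [set: rV] f ->
  measurable_fun [set: T * rV]
    (fun q => (psi (enorm q.2) * f (x - Y q.1 + E q.1 *: q.2)%R)%:E).
Proof.
move=> mE mY mf; apply/measurable_EFinP; apply: measurable_funM.
  exact: (measurableT_comp measurable_kernel measurable_snd).
exact: (measurableT_comp mf (measurable_shift x mE mY)).
Qed.

Context (psi1 : \int[mu]_u (psi (enorm u))%:E = 1).

Lemma integrable_kernel : mu.-integrable setT (fun u => (psi (enorm u))%:E).
Proof.
have [_ psi0 _ _ _] := HZ.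
apply/integrableP; split; first by apply/measurable_EFinP; exact: measurable_kernel.
under eq_integral do rewrite gee0_abs ?lee_fin//.
by rewrite psi1 ltry.
Qed.

(** The mean of g at x with scale p.1 and shift p.2. The mean operators applied to
    g are its integrals against the laws of (eps_j, y_j). Allowing every real scale,
    0 and negative ones included, makes it a function on the whole space where
    those laws converge. *)
Definition average (g : rV -> R) (x : rV) (p : R * rV) : R :=
  fine (\int[mu]_u (psi (enorm u) * g (x - p.2 + p.1 *: u)%R)%:E).

Section bounded.
Context (g : rV -> R) (M : R) (mg : measurable_fun [set: rV] g)
  (gM : forall x, (`|g x| <= M)%R).

Let M0 : (0 <= M)%R.
Proof. exact: le_trans (gM 0%R). Qed.

Lemma kernel_mul_le (u z : rV) : `|(psi (enorm u) * g z)%:E| <= M%:E * (psi (enorm u))%:E.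
Proof.
have [_ psi0 _ _ _] := HZ.
by rewrite abse_EFin -EFinM lee_fin normrM ger0_norm// mulrC ler_wpM2r.
Qed.

Lemma measurable_kernel_mul1 (c : rV) (e : R) :
  measurable_fun [set: rV] (fun u => (psi (enorm u) * g (c + e *: u)%R)%:E).
Proof.
apply/measurable_EFinP; apply: measurable_funM; first exact: measurable_kernel.
exact: (measurableT_comp mg (measurable_affine_rV c e)).
Qed.

Lemma integrable_kernel_mul (c : rV) (e : R) :
  mu.-integrable setT (fun u => (psi (enorm u) * g (c + e *: u)%R)%:E).
Proof.
have [_ psi0 _ _ _] := HZ.
apply: (le_integrable _ (measurable_kernel_mul1 c e) _ (integrableZl _ M integrable_kernel)) => //.
move=> u _; rewrite [leRHS]gee0_abs; first exact: kernel_mul_le.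
by rewrite mule_ge0 ?lee_fin.
Qed.

Lemma averageE (x : rV) (p : R * rV) :
  (average g x p)%:E = \int[mu]_u (psi (enorm u) * g (x - p.2 + p.1 *: u)%R)%:E.
Proof.
by rewrite /average fineK//; apply: integrable_fin_num => //; exact: integrable_kernel_mul.
Qed.

Lemma abs_kernel_mul_le (c : rV) (e : R) :
  \int[mu]_u `|(psi (enorm u) * g (c + e *: u)%R)%:E| <= M%:E.
Proof.
have [_ psi0 _ _ _] := HZ.
apply: (@le_trans _ _ (\int[mu]_u (M%:E * (psi (enorm u))%:E))).
  apply: ge0_le_integral => //.
  - apply: measurableT_comp => //; exact: measurable_kernel_mul1.
  - by apply: measurable_funeM; apply/measurable_EFinP; exact: measurable_kernel.
  - by move=> u _; exact: kernel_mul_le.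
have mk : measurable_fun setT (fun u : rV => (psi (enorm u))%:E).
  by apply/measurable_EFinP; exact: measurable_kernel.
by rewrite ge0_integralZl// ?psi1 ?mule1// => u _; rewrite lee_fin.
Qed.

Lemma average_bounded (x : rV) (p : R * rV) : (`|average g x p| <= M)%R.
Proof.
rewrite -lee_fin -abse_EFin averageE.
apply: le_trans (abs_kernel_mul_le (x - p.2)%R p.1).
by apply: le_abse_integral => //; exact: measurable_kernel_mul1.
Qed.

Lemma measurable_average (x : rV) : measurable_fun [set: R * rV] (average g x).
Proof.
have mf := measurable_kernel_mul x (@measurable_fst _ _ R rV) (@measurable_snd _ _ R rV) mg.
have mI := measurable_fun_integral mu mf.
exact: (measurableT_comp (fine_measurable measurableT) mI).
Qed.

Lemma average0 (x : rV) : average g x (0%R, 0%R) = g x.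
Proof.
apply/EFin_inj; rewrite averageE/=.
rewrite (eq_integral (fun u : rV => (g x)%:E * (psi (enorm u))%:E)).
  by rewrite integralZl//; [rewrite psi1 mule1|exact: integrable_kernel].
by move=> u _; rewrite subr0 scale0r addr0 mulrC.
Qed.

(** Dominated convergence, with M psi(|u|) as dominating function. *)
Lemma average_continuous (x : rV) : continuous g -> continuous (average g x).
Proof.
move=> cg; apply: continuous_seq => p s sp.
have [_ psi0 _ _ _] := HZ.
have s1 : (s k).1 @[k --> \oo] --> p.1 by apply: cvg_comp sp _; exact: cvg_fst.
have s2 : (s k).2 @[k --> \oo] --> p.2 by apply: cvg_comp sp _; exact: cvg_snd.
have arg (u : rV) :
    (x - (s k).2 + (s k).1 *: u)%R @[k --> \oo] --> (x - p.2 + p.1 *: u)%R.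
  apply: cvgD; first by apply: cvgB => //; exact: cvg_cst.
  by apply: cvgZ => //; exact: cvg_cst.
have lim (u : rV) :
    (psi (enorm u) * g (x - (s k).2 + (s k).1 *: u)%R)%:E @[k --> \oo] -->
    (psi (enorm u) * g (x - p.2 + p.1 *: u)%R)%:E.
  apply: cvg_EFin; first exact: nearW.
  apply: cvgM; first exact: cvg_cst.
  by apply: cvg_comp (arg u) _; exact: cg.
have [_ _ h] := @dominated_convergence _ _ _ mu setT measurableT
  (fun k u => (psi (enorm u) * g (x - (s k).2 + (s k).1 *: u)%R)%:E)
  (fun u => (psi (enorm u) * g (x - p.2 + p.1 *: u)%R)%:E)
  (fun u => M%:E * (psi (enorm u))%:E)
  (fun k => measurable_kernel_mul1 _ _) (measurable_kernel_mul1 _ _)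
  (aeW _ (fun u _ => lim u)) (integrableZl measurableT M integrable_kernel)
  (aeW _ (fun u k _ => kernel_mul_le _ _)).
by rewrite -averageE in h; exact: (fine_cvg h).
Qed.

End bounded.
End radial_kernel.

(** * Mean operators, maximal operator, test functions *)

Section mean_and_maximal.
Context (R : realType) (n : nat).
Local Open Scope ereal_scope.
Local Notation mu := (borel_lebesgue R n).
Local Notation rV := 'rV[R]_n.
Context (phi psi : R -> R) (Z : set rV) (HZ : borel_kernel_version phi psi Z)
  (psi1 : \int[mu]_u (psi (enorm u))%:E = 1).
Context (d : measure_display) (Omega : measurableType d) (P : probability Omega R)
    (eps : nat -> {RV P >-> R}) (y : nat -> {RV P >-> rV})
    (eps_gt0 : forall (j : nat) (w : Omega), (1 <= j)%N -> (0 < eps j w)%R).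

Definition integrand (f : rV -> R) (x : rV) (j : nat) (q : Omega * rV) : \bar R :=
  (psi (enorm q.2) * f (x - y j q.1 + eps j q.1 *: q.2)%R)%:E.

Lemma measurable_integrand f x j : measurable_fun [set: rV] f ->
  measurable_fun [set: Omega * rV] (integrand f x j).
Proof. by move=> mf; apply: (measurable_kernel_mul HZ). Qed.

Lemma mean_opE (f f' : rV -> R) (N : set rV) x j : (1 <= j)%N ->
  measurable N -> mu N = 0 -> (forall z, ~ N z -> f z = f' z) ->
  measurable_fun [set: rV] f' ->
  mean_op P phi eps y j f x = \int[P]_w \int[mu]_u integrand f' x j (w, u).
Proof.
move=> j1 mN muN ff' mf'; apply: eq_integral => w _.
apply: etrans (mean_inner HZ (x - y j w)%R (eps_gt0 w j1) mN muN ff' mf').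
by congr (_ * _); apply: eq_integral => z _; rewrite addrAC.
Qed.

Lemma maximal_op_ge (f f' : rV -> R) (N : set rV) x j : (1 <= j)%N ->
  measurable N -> mu N = 0 -> (forall z, ~ N z -> f z = f' z) ->
  measurable_fun [set: rV] f' ->
  \int[P]_w \int[mu]_u `|integrand f' x j (w, u)| <= maximal_op P phi eps y f x.
Proof.
move=> j1 mN muN ff' mf'; have [_ psi0 _ _ _] := HZ.
apply: ereal_sup_ubound; exists j => //; apply: eq_integral => w _.
have nf z : ~ N z -> (`|f z|)%R = (`|f' z|)%R by move=> nN; rewrite ff'.
have mnf' : measurable_fun [set: rV] (fun z => `|f' z|)%R by exact: measurableT_comp.
apply: etrans (maximal_inner HZ (x - y j w)%R (eps_gt0 w j1) mN muN nf mnf' _) _ => //.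
by apply: eq_integral => u _; rewrite abse_EFin normrM ger0_norm.
Qed.

(** Finiteness of the maximal function of f - g at x makes the integrands absolutely
    integrable over Omega * R^n. There the means are single integrals, so Fubini's
    theorem gives linearity of the mean operators at x although the inner integral
    of f may diverge for some w. *)
Lemma mean_op_sub_le (f f' g : rV -> R) (N : set rV) x j (l : R) : (1 <= j)%N ->
  measurable N -> mu N = 0 -> (forall z, ~ N z -> f z = f' z) ->
  measurable_fun [set: rV] f' -> test_fun g ->
  maximal_op P phi eps y (fun z => f z - g z)%R x <= l%:E ->
  `|mean_op P phi eps y j f x - mean_op P phi eps y j g x| <= l%:E.
Proof.
move=> j1 mN muN ff' mf' [_ mg [M gM] _] Ml.
rewrite (mean_opE x j1 mN muN ff' mf').
rewrite (mean_opE x j1 measurable0 (measure0 _) (fun z _ => erefl (g z)) mg).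
have mfg : measurable_fun [set: rV] (fun z => f' z - g z)%R by exact: measurable_funB.
have le : \int[P]_w \int[mu]_u `|integrand (fun z => f' z - g z)%R x j (w, u)| <= l%:E.
  apply: le_trans Ml; apply: (maximal_op_ge x j1 mN muN _ mfg).
  by move=> z nN; rewrite ff'.
pose Q := (P \x mu)%E.
have Ifg : Q.-integrable setT (integrand (fun z => f' z - g z)%R x j).
  apply/integrable12ltyP; first exact: measurable_integrand.
  by apply: le_lt_trans le _; exact: ltry.
have Ig : Q.-integrable setT (integrand g x j).
  apply/integrable12ltyP; first exact: measurable_integrand.
  apply: (@le_lt_trans _ _ (\int[P]_w M%:E)); last first.
    by rewrite integral_cst// [X in _ * X](probability_setT P) mule1 ltry.
  apply: ge0_le_integral => //.
  - by move=> w _; exact: integral_ge0.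
  - apply: (measurable_fun_integral mu (f := abse \o integrand g x j)).
    by apply: measurableT_comp => //; exact: measurable_integrand.
  - by move=> w _; exact: (abs_kernel_mul_le HZ psi1 mg gM (x - y j w)%R (eps j w)).
have If : Q.-integrable setT (integrand f' x j).
  rewrite (_ : integrand f' x j =
      integrand (fun z => f' z - g z)%R x j \+ integrand g x j).
    exact: (integrableD measurableT Ifg Ig).
  by apply/funext => q; rewrite /integrand/= -EFinD -mulrDr subrK.
rewrite (integral12_prod_meas1 If) (integral12_prod_meas1 Ig) -integralB//.
rewrite (eq_integral (integrand (fun z => f' z - g z)%R x j)); last first.
  by move=> q _; rewrite /integrand -EFinB -mulrBr.
apply: le_trans le.
rewrite -(fubini_tonelli1 (abse \o integrand (fun z => f' z - g z)%R x j))//=.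
  by apply: le_abse_integral => //; exact: measurable_integrand.
by apply: measurableT_comp => //; exact: measurable_integrand.
Qed.

Context (law_cvg : cvg_weakly_dirac (fun j => joint_law (eps j) (y j)) (0%R, 0%R)).

(** The mean operator on a test function is the integral of a bounded continuous
    function against the joint law, so weak convergence yields the value of that
    function at (0, 0), which is g x because the kernel has mass 1. *)
Lemma mean_op_test_cvg (g : rV -> R) x : test_fun g ->
  mean_op P phi eps y j g x @[j --> \oo] --> (g x)%:E.
Proof.
move=> [cg mg [M gM] _].
have cav : continuous (average psi g x).
  exact: (average_continuous HZ psi1 mg gM cg).
have bav : bounded_fun (average psi g x).
  exists M; split; first exact: num_real.
  move=> K MK p _; apply: le_trans (average_bounded HZ psi1 mg gM x p) _.
  exact: ltW.
have := law_cvg cav bav; rewrite (average0 HZ psi1 mg gM).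
apply: cvg_trans; apply: near_eq_cvg; near=> j.
have j1 : (1 <= j)%N by near: j; exact: nbhs_infty_ge.
rewrite (mean_opE x j1 measurable0 (measure0 _) (fun z _ => erefl (g z)) mg).
have mav := measurable_average HZ mg x.
rewrite /joint_law integral_distribution/=; last 2 first.
- exact/measurable_EFinP.
- apply: (@le_integrable _ _ _ P setT measurableT _ (cst M%:E)).
  + apply/measurable_EFinP; apply: (measurableT_comp mav).
    exact: measurable_fun_pair.
  + move=> w _; rewrite /= lee_fin [leRHS]ger0_norm; last exact: le_trans (gM 0%R).
    exact: (average_bounded HZ psi1 mg gM).
  + exact: finite_measure_integrable_cst.
by apply: eq_integral => w _; rewrite /= (averageE HZ psi1 mg gM).
Unshelve. all: by end_near. Qed.

(** Comparison through g: the means of f and g differ by at most l, the means of g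
    are eventually within l of g x, and g x is within l of f x. *)
Lemma mean_op_close (f f' g : rV -> R) (N : set rV) x (l : R) : (0 < l)%R ->
  measurable N -> mu N = 0 -> (forall z, ~ N z -> f z = f' z) ->
  measurable_fun [set: rV] f' -> test_fun g ->
  maximal_op P phi eps y (fun z => f z - g z)%R x <= l%:E ->
  (`|f x - g x| <= l)%R ->
  \forall j \near \oo, `|mean_op P phi eps y j f x - (f x)%:E| <= (l + l + l)%:E.
Proof.
move=> l0 mN muN ff' mf' tg Ml fgl.
have /fine_cvgP[gfin /cvgrPdist_le/(_ _ l0) glim] := @mean_op_test_cvg g x tg.
near=> j.
have j1 : (1 <= j)%N by near: j; exact: nbhs_infty_ge.
have := mean_op_sub_le j1 mN muN ff' mf' tg Ml.
have gj : mean_op P phi eps y j g x \is a fin_num by near: j.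
have : (`|g x - fine (mean_op P phi eps y j g x)| <= l)%R by near: j.
rewrite -(fineK gj); case: (mean_op P phi eps y j f x) => [r| |]//=.
rewrite !lee_fin; set m := fine _ => h1 h2.
move: h1 h2 fgl; rewrite !ler_norml => /andP[? ?] /andP[? ?] /andP[? ?].
by apply/andP; split; lra.
Unshelve. all: by end_near. Qed.

End mean_and_maximal.

(** * Almost everywhere convergence *)

Section lebesgue_sets.
Context (R : realType) (n : nat).
Local Open Scope ereal_scope.
Local Notation mu := (borel_lebesgue R n).
Local Notation rV := 'rV[R]_n.

Lemma lebesgue_negligible (A : set (lebRn R n)) :
  lebesgue A = 0 -> (@lebesgue R n).-negligible A.
Proof.
move=> A0; have [B [mB AB muB]] := measurable_hull mu A.
exists B; split => //; first exact: borel_measurable_lebesgue.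
by rewrite -A0; exact: etrans (lebesgue_borelE mB) muB.
Qed.

(** Arbitrary sets are allowed, Lebesgue measure being an outer measure: it is applied
    to superlevel sets of the maximal function, on whose measurability nothing is
    assumed. *)
Lemma lebesgue_sub_setU (A B C : set (lebRn R n)) : A `<=` B `|` C ->
  lebesgue A <= lebesgue B + lebesgue C.
Proof.
move=> ABC; apply: le_trans (outer_measureU2 ((mu^*)%mu) B C).
exact: (le_outer_measure (mu^*)%mu).
Qed.

Lemma lebesgue_markov (h : lebRn R n -> R) (l : R) : (0 < l)%R ->
  measurable_fun setT h ->
  lebesgue [set x | (l < `|h x|)%R] <= (l^-1)%:E * \int[lebesgue]_x `|h x|%:E.
Proof.
move=> l0 mh.
rewrite lee_pdivlMl//.
have := @le_integral_comp_abse _ _ _ (@lebesgue R n) setT measurableT (EFin \o h) l id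
  (@measurable_id _ _ _) (fun _ r => r) (fun _ _ _ _ r => r).
rewrite setTI => /(_ _ l0) h1; apply: le_trans (h1 _); last exact/measurable_EFinP.
rewrite lee_pmul2l//.
by apply: (le_outer_measure (mu^*)%mu) => x /= lx; rewrite lee_fin ltW.
Qed.

Lemma lebesgue_integrable_borel (f : lebRn R n -> R) :
  lebesgue.-integrable [set: lebRn R n] (EFin \o f) ->
  exists (f' : rV -> R) (N : set rV), [/\ measurable N, mu N = 0,
    forall z, ~ N z -> f z = f' z, measurable_fun [set: rV] f' &
    mu.-integrable [set: rV] (EFin \o f')].
Proof.
move=> If; have mf : measurable_fun [set: lebRn R n] f.
  by apply/measurable_EFinP; exact: measurable_int If.
have [N [mN muN mf']] := lebesgue_borel_off_null mf.
have ff' z : ~ N z -> f z = (f \_ (~` N)) z by move=> nN; rewrite patchE mem_set.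
exists (f \_ (~` N)), N; split => //.
apply/integrableP; split; first exact/measurable_EFinP.
have /integrableP[_] := If; apply: le_lt_trans.
rewrite (@integral_lebesgue_off_null _ _ N _ (fun z => `|((f \_ (~` N)) z)%:E|))//.
  by move=> z nN /=; rewrite ff'.
by apply: measurableT_comp => //; exact/measurable_EFinP.
Qed.

End lebesgue_sets.

Theorem theorem2p3 (R : realType) (n : nat) (hn : (1 <= n)%N)
    (phi : R -> R)
    (phi_ge0 : forall t : R, 0 < t -> 0 <= phi t)
    (phi_meas : measurable_fun (`]0, +oo[%classic : set (lebR R)) phi)
    (phi_int : (\int[@lebesgue R n]_x (phi (enorm x))%:E = 1)%E)
    (d : measure_display) (Omega : measurableType d) (P : probability Omega R)
    (eps : nat -> {RV P >-> R}) (y : nat -> {RV P >-> 'rV[R]_n})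
    (eps_gt0 : forall (j : nat) (w : Omega), (1 <= j)%N -> 0 < eps j w)
    (law_cvg : cvg_weakly_dirac (fun j => joint_law (eps j) (y j)) (0, 0))
    (weak11 : weak_type_11 (maximal_op P phi eps y)) :
  forall f : lebRn R n -> R,
    lebesgue.-integrable [set: lebRn R n] (EFin \o f) ->
    \forall x \ae lebesgue, mean_op P phi eps y j f x @[j --> \oo] --> (f x)%:E.
Proof.
move=> f If.
have [psi [Z HZ]] := radial_borel_version hn phi_ge0 phi_meas.
have [mpsi psi0 mZ muZ phipsi] := HZ.
have psi1 : (\int[borel_lebesgue R n]_u (psi (enorm u))%:E = 1)%E.
  rewrite -phi_int; apply/esym.
  apply: (integral_lebesgue_off_null mZ muZ) => [x nZ|]; first by rewrite phipsi.
  by apply/measurable_EFinP; exact: (measurable_kernel HZ).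
have [f' [N [mN muN ff' mf' If']]] := lebesgue_integrable_borel If.
have mf : measurable_fun [set: lebRn R n] f.
  by apply/measurable_EFinP; exact: measurable_int If.
pose bad (k : nat) : set (lebRn R n) := [set x | ~ \forall j \near \oo,
  (`|mean_op P phi eps y j f x - (f x)%:E| <= (k.+1%:R^-1)%:E)%E].
suff bad0 k : lebesgue (bad k) = 0%E.
  apply: negligibleS (negligible_bigcup (fun k => lebesgue_negligible (bad0 k))).
  move=> x /= nx; apply: contrapT => nbad; apply: nx.
  have close k : \forall j \near \oo,
      (`|mean_op P phi eps y j f x - (f x)%:E| <= (k.+1%:R^-1)%:E)%E.
    by apply: contrapT => nk; apply: nbad; exists k.
  apply/fine_cvgP; split.
    apply: filterS (close 0%N) => j.
    by case: (mean_op P phi eps y j f x).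
  apply/cvgrPdist_lt => e e0.
  have [k ke] : exists k : nat, k.+1%:R^-1 < e.
    near \oo => k; exists k; near: k; exact: near_infty_natSinv_lt (PosNum e0).
  apply: filterS (close k) => j /=.
  case: (mean_op P phi eps y j f x) => //= r.
  by rewrite lee_fin distrC => h; exact: le_lt_trans ke.
have [A A0 wA] := weak11.
(* three errors of size l add up to the tolerance 1/(k+1) that defines bad k *)
pose l : R := k.+1%:R^-1 / 3.
have l0 : 0 < l by rewrite divr_gt0.
apply/eqP; rewrite eq_le; apply/andP; split; last exact: outer_measure_ge0.
apply/lee_addgt0Pr => e e0; rewrite add0e.
have Al0 : 0 < A / l + l^-1 by rewrite addr_gt0 ?divr_gt0 ?invr_gt0.
(* the weak type bound contributes A / l and Markov's inequality 1 / l times the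
   L1 distance from f to g *)
have [g tg fg] := L1_approx_integrable If' (divr_gt0 e0 Al0).
have [_ mg _ Ig] := tg.
have mg' : measurable_fun [set: lebRn R n] g by exact: measurable_fun_lebRn.
have mfg : measurable_fun [set: lebRn R n] (fun z => f z - g z).
  exact: measurable_funB.
have intfg : (\int[lebesgue]_(x in [set: lebRn R n]) `|f x - g x|%:E =
    \int[borel_lebesgue R n]_x `|f' x - g x|%:E)%E.
  apply: (integral_lebesgue_off_null mN muN) => [z nN|]; first by rewrite ff'.
  by apply/measurable_EFinP; apply: measurableT_comp => //; exact: measurable_funB.
have Ifg : lebesgue.-integrable [set: lebRn R n] (EFin \o (fun z => f z - g z)).
  apply/integrableP; split; first exact/measurable_EFinP.
  have := fg; rewrite -intfg => /lt_trans; apply; exact: ltry.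
have sub : bad k `<=`
    [set x | (l%:E < maximal_op P phi eps y (fun z => (f z - g z)%R) x)%E] `|`
    [set x | l < `|f x - g x|].
  move=> x nx; apply: contrapT => /not_orP[/= /negP M1 /negP M2]; apply: nx.
  rewrite -!leNgt in M1 M2.
  have := mean_op_close HZ psi1 eps_gt0 law_cvg l0 mN muN ff' mf' tg M1 M2.
  apply: filterS => j; rewrite (_ : l + l + l = k.+1%:R^-1)//.
  by rewrite /l; field.
apply: (le_trans (lebesgue_sub_setU sub)).
apply: (le_trans (leeD (wA l _ l0 Ifg) (lebesgue_markov l0 mfg))).
rewrite intfg -ge0_muleDl ?lee_fin ?invr_ge0 ?divr_ge0 ?ltW// -EFinD.
by rewrite -lte_pdivlMl// -EFinM mulrC.
Unshelve. all: by end_near. Qed.
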